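(* The calculus $LS_{PASL}+\{S,\neq L,EM,CS,CS_C\}$ is sound and cut-free complete with respect to the class of PASL Kripke relational frames satisfying splittability and cross-split: for every formula $F$, (i) if $\emptyset;\emptyset\vdash w:F$ is derivable in this calculus (possibly with cut) for some label $w$, then $F$ is valid over this class of frames; and (ii) if $F$ is valid over this class, then $\emptyset;\emptyset\vdash w:F$ is derivable in this calculus without cut for some label variable $w$.
   Context: Formulae: $A ::= p \mid \top\mid\bot\mid\neg A\mid A\vee A\mid A\wedge A\mid A\to A\mid \top^*\mid A*A\mid A\mathrel{-\!\!*}A$, $p\in Var$. Semantics. A PASL Kripke relational frame is $(H,R,\epsilon)$, $H$ nonempty, $R\subseteq H^3$, $\epsilon\in H$, such that for all $h_i\in H$: $R(h_1,\epsilon,h_2)\iff h_1=h_2$; $R(h_1,h_2,h_3)\iff R(h_2,h_1,h_3)$; $R(h_1,h_5,h_4)\wedge R(h_2,h_3,h_5)\Rightarrow\exists h_6\,(R(h_6,h_3,h_4)\wedge R(h_1,h_2,h_6))$; $R(h_1,h_2,h_3)\wedge R(h_1,h_4,h_3)\Rightarrow h_2=h_4$; $R(h_1,h_2,h_3)\wedge R(h_1,h_2,h_4)\Rightarrow h_3=h_4$. Splittability: for every $h_0\neq\epsilon$ there are $h_1\neq\epsilon$, $h_2\neq\epsilon$ with $R(h_1,h_2,h_0)$. Cross-split: if $R(h_1,h_2,h_0)$ and $R(h_3,h_4,h_0)$ then there are $h_{13},h_{14},h_{23},h_{24}$ with $R(h_{13},h_{14},h_1)$, $R(h_{23},h_{24},h_2)$,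 $R(h_{13},h_{23},h_3)$, $R(h_{14},h_{24},h_4)$. A model adds $\nu:Var\to\mathcal{P}(H)$; forcing: $h\Vdash p$ iff $h\in\nu(p)$; $\top$ always, $\bot$ never; $\neg,\wedge,\vee,\to$ classical; $h\Vdash\top^*$ iff $h=\epsilon$; $h\Vdash A*B$ iff $\exists h_1,h_2$ with $R(h_1,h_2,h)$, $h_1\Vdash A$, $h_2\Vdash B$; $h\Vdash A\mathrel{-\!\!*}B$ iff $\forall h_1,h_2$, $R(h,h_1,h_2)$ and $h_1\Vdash A$ imply $h_2\Vdash B$. Valid over a class = forced at every world of every model on a frame in the class. Calculus. Labels: $LVar\cup\{\epsilon\}$. Labelled formula $a:A$; relational atom $(a,b\triangleright c)$; inequality $(a\neq b)$. Sequent $\mathcal{G};\Gamma\vdash\Delta$ with $\mathcal{G}$ a set of relational atoms and inequalities and $\Gamma,\Delta$ multisets of labelled formulae; $[y/x]$ ($x$ label variable) uniform replacement; $\neg A:=A\to\bot$, $A\vee B:=\neg A\to B$. $LS_{PASL}$ rules (fresh = label variable not in conclusion): $id$: axiom $\mathcal{G};\Gamma,w:p\vdash w:p,\Delta$; $cut$: $\mathcal{G};\Gamma\vdash x:A,\Delta$ and $\mathcal{G}';\Gamma',x:A\vdash\Delta'\Rightarrow\mathcal{G},\mathcal{G}';\Gamma,\Gamma'\vdash\Delta,\Delta'$; $\bot L$: axiom $\mathcal{G};\Gamma,w:\bot\vdash\Delta$; $\top R$: axiom $\mathcal{G};\Gamma\vdash w:\top,\Delta$; $\top^*R$: axiom $\mathcal{G};\Gamma\vdash\epsilon:\top^*,\Delta$;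 $\top^*L$: $(\epsilon,w\triangleright\epsilon),\mathcal{G};\Gamma\vdash\Delta\Rightarrow\mathcal{G};\Gamma,w:\top^*\vdash\Delta$; $\wedge L$: $\mathcal{G};\Gamma,w:A,w:B\vdash\Delta\Rightarrow\mathcal{G};\Gamma,w:A\wedge B\vdash\Delta$; $\wedge R$: $\mathcal{G};\Gamma\vdash w:A,\Delta$ and $\mathcal{G};\Gamma\vdash w:B,\Delta\Rightarrow\mathcal{G};\Gamma\vdash w:A\wedge B,\Delta$; $\to L$: $\mathcal{G};\Gamma\vdash w:A,\Delta$ and $\mathcal{G};\Gamma,w:B\vdash\Delta\Rightarrow\mathcal{G};\Gamma,w:A\to B\vdash\Delta$; $\to R$: $\mathcal{G};\Gamma,w:A\vdash w:B,\Delta\Rightarrow\mathcal{G};\Gamma\vdash w:A\to B,\Delta$; $*L$: $(x,y\triangleright z),\mathcal{G};\Gamma,x:A,y:B\vdash\Delta\Rightarrow\mathcal{G};\Gamma,z:A*B\vdash\Delta$ ($x,y$ fresh); $\mathrel{-\!\!*}R$: $(x,z\triangleright y),\mathcal{G};\Gamma,x:A\vdash y:B,\Delta\Rightarrow\mathcal{G};\Gamma\vdash z:A\mathrel{-\!\!*}B,\Delta$ ($x,y$ fresh); $*R$: $(x,y\triangleright z),\mathcal{G};\Gamma\vdash x:A,z:A*B,\Delta$ and $(x,y\triangleright z),\mathcal{G};\Gamma\vdash y:B,z:A*B,\Delta\Rightarrow(x,y\triangleright z),\mathcal{G};\Gamma\vdash z:A*B,\Delta$; $\mathrel{-\!\!*}L$: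 $(x,y\triangleright z),\mathcal{G};\Gamma,y:A\mathrel{-\!\!*}B\vdash x:A,\Delta$ and $(x,y\triangleright z),\mathcal{G};\Gamma,y:A\mathrel{-\!\!*}B,z:B\vdash\Delta\Rightarrow(x,y\triangleright z),\mathcal{G};\Gamma,y:A\mathrel{-\!\!*}B\vdash\Delta$; $E$: $(y,x\triangleright z),(x,y\triangleright z),\mathcal{G};\Gamma\vdash\Delta\Rightarrow(x,y\triangleright z),\mathcal{G};\Gamma\vdash\Delta$; $A$: $(u,w\triangleright z),(y,v\triangleright w),(x,y\triangleright z),(u,v\triangleright x),\mathcal{G};\Gamma\vdash\Delta\Rightarrow(x,y\triangleright z),(u,v\triangleright x),\mathcal{G};\Gamma\vdash\Delta$ ($w$ fresh); $U$: $(x,\epsilon\triangleright x),\mathcal{G};\Gamma\vdash\Delta\Rightarrow\mathcal{G};\Gamma\vdash\Delta$; $A_C$: $(x,w\triangleright x),(y,y\triangleright w),(x,y\triangleright x),\mathcal{G};\Gamma\vdash\Delta\Rightarrow(x,y\triangleright x),\mathcal{G};\Gamma\vdash\Delta$ ($w$ fresh); $Eq_1$: $(\epsilon,w'\triangleright w'),\mathcal{G}[w'/w];\Gamma[w'/w]\vdash\Delta[w'/w]\Rightarrow(\epsilon,w\triangleright w'),\mathcal{G};\Gamma\vdash\Delta$; $Eq_2$: same premise $\Rightarrow(\epsilon,w'\triangleright w),\mathcal{G};\Gamma\vdash\Delta$; $P$: $(x,y\triangleright z),\mathcal{G}[z/w];\Gamma[z/w]\vdash\Delta[z/w]\Rightarrow(x,y\triangleright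 z),(x,y\triangleright w),\mathcal{G};\Gamma\vdash\Delta$; $C$: $(x,y\triangleright z),\mathcal{G}[y/w];\Gamma[y/w]\vdash\Delta[y/w]\Rightarrow(x,y\triangleright z),(x,w\triangleright z),\mathcal{G};\Gamma\vdash\Delta$ (in $Eq_1,Eq_2,P,C$, $w$ a label variable). Additional rules: $S$: $(x,y\triangleright z),(x\neq\epsilon),(y\neq\epsilon),(z\neq\epsilon),\mathcal{G};\Gamma\vdash\Delta\Rightarrow(z\neq\epsilon),\mathcal{G};\Gamma\vdash\Delta$ ($x,y$ fresh); $\neq L$: axiom $(w\neq w),\mathcal{G};\Gamma\vdash\Delta$; $EM$: $(w\neq\epsilon),\mathcal{G};\Gamma\vdash\Delta$ and $(\epsilon,w\triangleright\epsilon),\mathcal{G};\Gamma\vdash\Delta\Rightarrow\mathcal{G};\Gamma\vdash\Delta$; $CS$: $(p,q\triangleright x),(p,s\triangleright u),(s,t\triangleright y),(q,t\triangleright v),(x,y\triangleright z),(u,v\triangleright z),\mathcal{G};\Gamma\vdash\Delta\Rightarrow(x,y\triangleright z),(u,v\triangleright z),\mathcal{G};\Gamma\vdash\Delta$ ($p,q,s,t$ fresh); $CS_C$: $(p,q\triangleright x),(p,s\triangleright x),(s,t\triangleright y),(q,t\triangleright y),(x,y\triangleright z),\mathcal{G};\Gamma\vdash\Delta\Rightarrow(x,y\triangleright z),\mathcal{G};\Gamma\vdash\Delta$ ($p,q,s,t$ fresh).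
   Formalization: In (i), ''some label w'' is restricted to label variables: for w = ε the claim fails, since ε:⊤* is an axiom (⊤*R) although ⊤* is not valid over the class (e.g. nonnegative reals under addition). *)

(* Defs.v *)
From Stdlib Require Import List Permutation PeanoNat.
Import ListNotations.

Set Implicit Arguments.

(** * Formulae and Kripke semantics *)

Inductive formula (Var : Type) : Type :=
| FVar (p : Var)
| FTop
| FBot
| FNot (A : formula Var)
| FOr (A B : formula Var)
| FAnd (A B : formula Var)
| FImp (A B : formula Var)
| FEmp
| FStar (A B : formula Var)
| FWand (A B : formula Var).

Arguments FTop {Var}.
Arguments FBot {Var}.
Arguments FEmp {Var}.

(** [rel h1 h2 h3] reads "[h1] combined with [h2] gives [h3]".  The carrier is
    nonempty because it contains [neutral]. *)
Record frame : Type := Frame {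
  world : Type;
  rel : world -> world -> world -> Prop;
  neutral : world;
  rel_identity : forall h1 h2, rel h1 neutral h2 <-> h1 = h2;
  rel_comm : forall h1 h2 h3, rel h1 h2 h3 <-> rel h2 h1 h3;
  rel_assoc : forall h1 h2 h3 h4 h5,
    rel h1 h5 h4 /\ rel h2 h3 h5 ->
    exists h6, rel h6 h3 h4 /\ rel h1 h2 h6;
  rel_cancel : forall h1 h2 h3 h4,
    rel h1 h2 h3 /\ rel h1 h4 h3 -> h2 = h4;
  rel_functional : forall h1 h2 h3 h4,
    rel h1 h2 h3 /\ rel h1 h2 h4 -> h3 = h4
}.

Arguments rel {f} _ _ _.
Arguments neutral {f}.

Definition splittable (M : frame) : Prop :=
  forall h0 : world M, h0 <> neutral ->
    exists h1 h2 : world M, h1 <> neutral /\ h2 <> neutral /\ rel h1 h2 h0.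

Definition cross_split (M : frame) : Prop :=
  forall h0 h1 h2 h3 h4 : world M,
    rel h1 h2 h0 -> rel h3 h4 h0 ->
    exists h13 h14 h23 h24 : world M,
      rel h13 h14 h1 /\ rel h23 h24 h2 /\ rel h13 h23 h3 /\ rel h14 h24 h4.

Fixpoint forces (Var : Type) (M : frame) (nu : Var -> world M -> Prop)
    (h : world M) (F : formula Var) : Prop :=
  match F with
  | FVar p => nu p h
  | FTop => True
  | FBot => False
  | FNot A => ~ forces M nu h A
  | FOr A B => forces M nu h A \/ forces M nu h B
  | FAnd A B => forces M nu h A /\ forces M nu h B
  | FImp A B => forces M nu h A -> forces M nu h B
  | FEmp => h = neutral
  | FStar A B => exists h1 h2,
      rel h1 h2 h /\ forces M nu h1 A /\ forces M nu h2 B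
  | FWand A B => forall h1 h2,
      rel h h1 h2 -> forces M nu h1 A -> forces M nu h2 B
  end.

Definition valid_over (Var : Type) (C : frame -> Prop) (F : formula Var)
    : Prop :=
  forall M : frame, C M ->
  forall (nu : Var -> world M -> Prop) (h : world M), forces M nu h F.

(** * The labelled calculus *)

(** Formulae of the calculus, where negation and disjunction are
    abbreviations. *)
Inductive cformula (Var : Type) : Type :=
| CVar (p : Var)
| CTop
| CBot
| CAnd (A B : cformula Var)
| CImp (A B : cformula Var)
| CEmp
| CStar (A B : cformula Var)
| CWand (A B : cformula Var).

Arguments CTop {Var}.
Arguments CBot {Var}.
Arguments CEmp {Var}.

Definition CNot (Var : Type) (A : cformula Var) : cformula Var := CImp A CBot.

Definition COr (Var : Type) (A B : cformula Var) : cformula Var :=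
  CImp (CNot A) B.

Fixpoint desugar (Var : Type) (F : formula Var) : cformula Var :=
  match F with
  | FVar p => CVar p
  | FTop => CTop
  | FBot => CBot
  | FNot A => CNot (desugar A)
  | FOr A B => COr (desugar A) (desugar B)
  | FAnd A B => CAnd (desugar A) (desugar B)
  | FImp A B => CImp (desugar A) (desugar B)
  | FEmp => CEmp
  | FStar A B => CStar (desugar A) (desugar B)
  | FWand A B => CWand (desugar A) (desugar B)
  end.

Definition LVar : Type := nat.

Inductive label : Type :=
| LEps
| LV (x : LVar).

(** [ARel a b c] is the relational atom (a, b |> c); [ANeq a b] is the
    inequality (a <> b). *)
Inductive atom : Type :=
| ARel (a b c : label)
| ANeq (a b : label).

Definition lformula (Var : Type) : Type := (label * cformula Var)%type.

(** The substitution [y/x] on labels, atoms and labelled formulae. *)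
Definition subst_label (y : label) (x : LVar) (l : label) : label :=
  match l with
  | LEps => LEps
  | LV z => if Nat.eqb z x then y else LV z
  end.

Definition subst_atom (y : label) (x : LVar) (a : atom) : atom :=
  match a with
  | ARel l1 l2 l3 =>
      ARel (subst_label y x l1) (subst_label y x l2) (subst_label y x l3)
  | ANeq l1 l2 => ANeq (subst_label y x l1) (subst_label y x l2)
  end.

Definition subst_lformula (Var : Type) (y : label) (x : LVar)
    (f : lformula Var) : lformula Var :=
  (subst_label y x (fst f), snd f).

Definition substG (y : label) (x : LVar) : list atom -> list atom :=
  map (subst_atom y x).

Definition substL (Var : Type) (y : label) (x : LVar)
    : list (lformula Var) -> list (lformula Var) :=
  map (subst_lformula y x).

Definition atom_labels (a : atom) : list label :=
  match a with
  | ARel l1 l2 l3 => [l1; l2; l3]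
  | ANeq l1 l2 => [l1; l2]
  end.

Definition sequent_labels (Var : Type) (G : list atom)
    (Gam Del : list (lformula Var)) : list label :=
  flat_map atom_labels G ++ map fst Gam ++ map fst Del.

(** The label variables [xs] are pairwise distinct and do not occur in the
    sequent [G; Gam |- Del]. *)
Definition fresh (Var : Type) (xs : list LVar) (G : list atom)
    (Gam Del : list (lformula Var)) : Prop :=
  NoDup xs /\ forall x, In x xs -> ~ In (LV x) (sequent_labels G Gam Del).

(** [derivable with_cut G Gam Del]: the sequent [G; Gam |- Del] is derivable in
    LS_PASL + {S, <>L, EM, CS, CS_C}; cut may be used only if [with_cut] is
    [true].

    A list [G] stands for the set of its elements, and [Gam], [Del] stand for
    multisets.  [d_repr] only changes the representatives of these quotients:
    every other rule shows its active atoms and formulae at the head of the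
    lists.  As [G] is a set, its displayed atoms may coincide, and may also
    occur in the remaining part of [G]. *)
Inductive derivable (Var : Type) (with_cut : bool)
  : list atom -> list (lformula Var) -> list (lformula Var) -> Prop :=
| d_repr : forall G G' Gam Gam' Del Del',
    (forall a, In a G <-> In a G') ->
    Permutation Gam Gam' ->
    Permutation Del Del' ->
    derivable with_cut G Gam Del ->
    derivable with_cut G' Gam' Del'

| d_id : forall G Gam Del w p,
    derivable with_cut G ((w, CVar p) :: Gam) ((w, CVar p) :: Del)
| d_cut : forall G G' Gam Gam' Del Del' x A,
    with_cut = true ->
    derivable with_cut G Gam ((x, A) :: Del) ->
    derivable with_cut G' ((x, A) :: Gam') Del' ->
    derivable with_cut (G ++ G') (Gam ++ Gam') (Del ++ Del')

| d_BotL : forall G Gam Del w,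
    derivable with_cut G ((w, CBot) :: Gam) Del
| d_TopR : forall G Gam Del w,
    derivable with_cut G Gam ((w, CTop) :: Del)
| d_EmpL : forall G Gam Del w,
    derivable with_cut (ARel LEps w LEps :: G) Gam Del ->
    derivable with_cut G ((w, CEmp) :: Gam) Del
| d_EmpR : forall G Gam Del,
    derivable with_cut G Gam ((LEps, CEmp) :: Del)
| d_AndL : forall G Gam Del w A B,
    derivable with_cut G ((w, A) :: (w, B) :: Gam) Del ->
    derivable with_cut G ((w, CAnd A B) :: Gam) Del
| d_AndR : forall G Gam Del w A B,
    derivable with_cut G Gam ((w, A) :: Del) ->
    derivable with_cut G Gam ((w, B) :: Del) ->
    derivable with_cut G Gam ((w, CAnd A B) :: Del)
| d_ImpL : forall G Gam Del w A B,
    derivable with_cut G Gam ((w, A) :: Del) ->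
    derivable with_cut G ((w, B) :: Gam) Del ->
    derivable with_cut G ((w, CImp A B) :: Gam) Del
| d_ImpR : forall G Gam Del w A B,
    derivable with_cut G ((w, A) :: Gam) ((w, B) :: Del) ->
    derivable with_cut G Gam ((w, CImp A B) :: Del)
| d_StarL : forall G Gam Del (x y : LVar) z A B,
    fresh [x; y] G ((z, CStar A B) :: Gam) Del ->
    derivable with_cut (ARel (LV x) (LV y) z :: G)
      ((LV x, A) :: (LV y, B) :: Gam) Del ->
    derivable with_cut G ((z, CStar A B) :: Gam) Del
| d_StarR : forall G Gam Del x y z A B,
    derivable with_cut (ARel x y z :: G) Gam
      ((x, A) :: (z, CStar A B) :: Del) ->
    derivable with_cut (ARel x y z :: G) Gam
      ((y, B) :: (z, CStar A B) :: Del) ->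
    derivable with_cut (ARel x y z :: G) Gam ((z, CStar A B) :: Del)
| d_WandL : forall G Gam Del x y z A B,
    derivable with_cut (ARel x y z :: G)
      ((y, CWand A B) :: Gam) ((x, A) :: Del) ->
    derivable with_cut (ARel x y z :: G)
      ((y, CWand A B) :: (z, B) :: Gam) Del ->
    derivable with_cut (ARel x y z :: G) ((y, CWand A B) :: Gam) Del
| d_WandR : forall G Gam Del (x y : LVar) z A B,
    fresh [x; y] G Gam ((z, CWand A B) :: Del) ->
    derivable with_cut (ARel (LV x) z (LV y) :: G)
      ((LV x, A) :: Gam) ((LV y, B) :: Del) ->
    derivable with_cut G Gam ((z, CWand A B) :: Del)

| d_E : forall G Gam Del x y z,
    derivable with_cut (ARel y x z :: ARel x y z :: G) Gam Del ->
    derivable with_cut (ARel x y z :: G) Gam Del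
| d_A : forall G Gam Del x y z u v (w : LVar),
    fresh [w] (ARel x y z :: ARel u v x :: G) Gam Del ->
    derivable with_cut
      (ARel u (LV w) z :: ARel y v (LV w) :: ARel x y z :: ARel u v x :: G)
      Gam Del ->
    derivable with_cut (ARel x y z :: ARel u v x :: G) Gam Del
| d_U : forall G Gam Del x,
    derivable with_cut (ARel x LEps x :: G) Gam Del ->
    derivable with_cut G Gam Del
| d_AC : forall G Gam Del x y (w : LVar),
    fresh [w] (ARel x y x :: G) Gam Del ->
    derivable with_cut
      (ARel x (LV w) x :: ARel y y (LV w) :: ARel x y x :: G) Gam Del ->
    derivable with_cut (ARel x y x :: G) Gam Del
| d_Eq1 : forall G Gam Del (w : LVar) w',
    derivable with_cut (ARel LEps w' w' :: substG w' w G)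
      (substL w' w Gam) (substL w' w Del) ->
    derivable with_cut (ARel LEps (LV w) w' :: G) Gam Del
| d_Eq2 : forall G Gam Del (w : LVar) w',
    derivable with_cut (ARel LEps w' w' :: substG w' w G)
      (substL w' w Gam) (substL w' w Del) ->
    derivable with_cut (ARel LEps w' (LV w) :: G) Gam Del
| d_P : forall G Gam Del x y z (w : LVar),
    derivable with_cut (ARel x y z :: substG z w G)
      (substL z w Gam) (substL z w Del) ->
    derivable with_cut (ARel x y z :: ARel x y (LV w) :: G) Gam Del
| d_C : forall G Gam Del x y z (w : LVar),
    derivable with_cut (ARel x y z :: substG y w G)
      (substL y w Gam) (substL y w Del) ->
    derivable with_cut (ARel x y z :: ARel x (LV w) z :: G) Gam Del

| d_S : forall G Gam Del (x y : LVar) z,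
    fresh [x; y] (ANeq z LEps :: G) Gam Del ->
    derivable with_cut
      (ARel (LV x) (LV y) z :: ANeq (LV x) LEps :: ANeq (LV y) LEps ::
       ANeq z LEps :: G) Gam Del ->
    derivable with_cut (ANeq z LEps :: G) Gam Del
| d_NeqL : forall G Gam Del w,
    derivable with_cut (ANeq w w :: G) Gam Del
| d_EM : forall G Gam Del w,
    derivable with_cut (ANeq w LEps :: G) Gam Del ->
    derivable with_cut (ARel LEps w LEps :: G) Gam Del ->
    derivable with_cut G Gam Del
| d_CS : forall G Gam Del x y z u v (p q s t : LVar),
    fresh [p; q; s; t] (ARel x y z :: ARel u v z :: G) Gam Del ->
    derivable with_cut
      (ARel (LV p) (LV q) x :: ARel (LV p) (LV s) u ::
       ARel (LV s) (LV t) y :: ARel (LV q) (LV t) v ::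
       ARel x y z :: ARel u v z :: G) Gam Del ->
    derivable with_cut (ARel x y z :: ARel u v z :: G) Gam Del
| d_CSC : forall G Gam Del x y z (p q s t : LVar),
    fresh [p; q; s; t] (ARel x y z :: G) Gam Del ->
    derivable with_cut
      (ARel (LV p) (LV q) x :: ARel (LV p) (LV s) x ::
       ARel (LV s) (LV t) y :: ARel (LV q) (LV t) y ::
       ARel x y z :: G) Gam Del ->
    derivable with_cut (ARel x y z :: G) Gam Del.

(* Main.v *)
Require Import Defs.
From Stdlib Require Import List Permutation PeanoNat Lia Classical ClassicalEpsilon
  FunctionalExtensionality PropExtensionality Eqdep_dec.
Import ListNotations.

Set Implicit Arguments.

(** Soundness: a rule whose conclusion is refuted by a valuation of the labels
    has a premise refuted by some valuation.

    Completeness: from an underivable sequent, apply the rules backwards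
    fairly, keeping the sequent underivable.  Fairness needs no enumeration of
    rule instances: a state has finitely many obligations, each can be met in
    every later state and stays met, so one stage discharges all of them.  In
    the limit, the labels modulo "identified at some stage" form a frame
    refuting the formula.  The substitution rules are what makes this delicate;
    since the displayed atom of Eq1, Eq2, P and C is not substituted into, it is
    simply kept in the sequent, so that no admissibility of weakening is used;
    recording consumed formulae separately avoids contraction. *)

(** * Soundness *)

(** The main obstacle is that Eq1, Eq2, P and C rename labels, so an obligation stated about the
    sequent may cease to make sense. Obligations are therefore stated in the names under which
    labels were first recorded, and [sub] tells what each name has become. Substitutions are only
    composed, so names once identified stay identified: a side condition such as
    [sub S z = sub S z'] persists, and a rule that needs two atoms to share a label can be demanded
    as soon as their names agree under [sub]. A second gap concerns splittability. Every world other
    than the neutral one must split, but S acts only on an inequality that is present. EM decides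
    each label against epsilon, and the axiom for inequalities ensures that a recorded inequality is
    never contradicted by a later identification. *)

Fixpoint cforces (Var : Type) (M : frame) (nu : Var -> world M -> Prop)
    (h : world M) (A : cformula Var) : Prop :=
  match A with
  | CVar p => nu p h
  | CTop => True
  | CBot => False
  | CAnd A B => cforces M nu h A /\ cforces M nu h B
  | CImp A B => cforces M nu h A -> cforces M nu h B
  | CEmp => h = neutral
  | CStar A B => exists h1 h2,
      rel h1 h2 h /\ cforces M nu h1 A /\ cforces M nu h2 B
  | CWand A B => forall h1 h2,
      rel h h1 h2 -> cforces M nu h1 A -> cforces M nu h2 B
  end.

Lemma cforces_desugar (Var : Type) (M : frame) (nu : Var -> world M -> Prop)
    (F : formula Var) (h : world M) :
  cforces M nu h (desugar F) <-> forces M nu h F.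
Proof.
  revert h; induction F as [p| | |A IHA|A IHA B IHB|A IHA B IHB|A IHA B IHB|
    |A IHA B IHB|A IHA B IHB]; intros h; simpl; try tauto.
  - rewrite IHA; tauto.
  - rewrite IHA, IHB.
    (* The encoding of disjunction by implication is faithful only classically. *)
    destruct (classic (forces M nu h A)); tauto.
  - rewrite IHA, IHB; tauto.
  - rewrite IHA, IHB; tauto.
  - split; intros (h1 & h2 & Hr & HA & HB); exists h1, h2;
      (split; [exact Hr|split; [apply IHA|apply IHB]; assumption]).
  - split; intros H h1 h2 Hr HA; apply IHB; apply (H h1 h2 Hr); apply IHA, HA.
Qed.

Definition atom_holds (M : frame) (rho : label -> world M) (a : atom) : Prop :=
  match a with
  | ARel a b c => rel (rho a) (rho b) (rho c)
  | ANeq a b => rho a <> rho b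
  end.

Definition lholds (Var : Type) (M : frame) (nu : Var -> world M -> Prop)
    (rho : label -> world M) (f : lformula Var) : Prop :=
  cforces M nu (rho (fst f)) (snd f).

(** The valuation [rho] is total on labels, with epsilon pinned to the neutral world by a conjunct;
    a substitution can then treat epsilon like any other replacing label. *)
Definition refutes (Var : Type) (M : frame) (nu : Var -> world M -> Prop)
    (rho : label -> world M) (G : list atom) (Gam Del : list (lformula Var))
    : Prop :=
  rho LEps = neutral /\ Forall (atom_holds M rho) G /\
  Forall (lholds M nu rho) Gam /\ Forall (fun f => ~ lholds M nu rho f) Del.

Lemma refutes_agree (Var : Type) (M : frame) (nu : Var -> world M -> Prop)
    (rho rho' : label -> world M) (G : list atom)
    (Gam Del : list (lformula Var)) :
  rho' LEps = rho LEps ->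
  (forall l, In l (sequent_labels G Gam Del) -> rho' l = rho l) ->
  refutes M nu rho G Gam Del -> refutes M nu rho' G Gam Del.
Proof.
  unfold sequent_labels.
  intros He Hl (H0 & HG & HL & HR).
  rewrite Forall_forall in HG, HL, HR.
  split; [congruence|].
  split; [|split]; apply Forall_forall.
  - intros a Ha. specialize (HG a Ha).
    assert (Hin : forall l, In l (atom_labels a) -> rho' l = rho l).
    { intros l Hla. apply Hl, in_or_app. left. apply in_flat_map. eauto. }
    destruct a; simpl in *; rewrite !Hin by auto; exact HG.
  - intros f Hf. specialize (HL f Hf). unfold lholds in *.
    rewrite Hl; [exact HL|].
    apply in_or_app; right; apply in_or_app; left; apply in_map, Hf.
  - intros f Hf. specialize (HR f Hf). unfold lholds in *.
    rewrite Hl; [exact HR|].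
    apply in_or_app; right; apply in_or_app; right; apply in_map, Hf.
Qed.

(** All eigenvariables of a rule (one, two or four) are reassigned at once. Distinctness of [xs]
    keeps the value given to the head from overwriting those of the tail. *)
Lemma env_extension (W : Type) (rho : label -> W) (xs : list LVar) :
  NoDup xs -> forall hs, length hs = length xs ->
  exists rho', map (fun x => rho' (LV x)) xs = hs /\
    forall l, (forall x, In x xs -> l <> LV x) -> rho' l = rho l.
Proof.
  induction xs as [|x xs IH]; intros Hnd hs Hlen.
  - destruct hs; [|discriminate]. exists rho. auto.
  - destruct hs as [|h hs]; [discriminate|].
    inversion Hnd as [|? ? Hx Hxs]; subst.
    destruct (IH Hxs hs) as (r & Hr1 & Hr2); [simpl in Hlen; lia|].
    exists (fun l => match l with
                     | LEps => r LEps
                     | LV z => if Nat.eqb z x then h else r l end).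
    split.
    + simpl. rewrite Nat.eqb_refl. f_equal.
      rewrite <- Hr1. apply map_ext_in. intros z Hz.
      destruct (Nat.eqb_spec z x); [subst; contradiction|reflexivity].
    + intros l Hl. rewrite <- Hr2 by (intros; apply Hl; simpl; auto).
      destruct l as [|z]; [reflexivity|].
      destruct (Nat.eqb_spec z x); [|reflexivity].
      subst. exfalso. apply (Hl x); simpl; auto.
Qed.

Lemma refutes_fresh (Var : Type) (M : frame) (nu : Var -> world M -> Prop)
    (rho : label -> world M) (xs : list LVar) (hs : list (world M))
    (G : list atom) (Gam Del : list (lformula Var)) :
  fresh xs G Gam Del -> length hs = length xs -> refutes M nu rho G Gam Del ->
  exists rho', map (fun x => rho' (LV x)) xs = hs /\
    (forall l, In l (sequent_labels G Gam Del) -> rho' l = rho l) /\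
    refutes M nu rho' G Gam Del.
Proof.
  intros [Hnd Hf] Hlen Href.
  destruct (env_extension rho Hnd hs Hlen) as (r & Hr1 & Hr2).
  assert (Hl : forall l, In l (sequent_labels G Gam Del) -> r l = rho l).
  { intros l Hl. apply Hr2. intros x Hx ->. exact (Hf x Hx Hl). }
  exists r. split; [exact Hr1|split; [exact Hl|]].
  apply refutes_agree with (rho := rho); auto.
  apply Hr2. discriminate.
Qed.

(** A valuation that gives [y] and [x] the same world cannot see the replacement of one by the
    other. *)
Lemma refutes_subst (Var : Type) (M : frame) (nu : Var -> world M -> Prop)
    (rho : label -> world M) (y : label) (x : LVar)
    (G : list atom) (Gam Del : list (lformula Var)) :
  rho y = rho (LV x) -> refutes M nu rho G Gam Del ->
  refutes M nu rho (substG y x G) (substL y x Gam) (substL y x Del).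
Proof.
  intros He.
  assert (Hs : forall l, rho (subst_label y x l) = rho l).
  { intros [|z]; simpl; [reflexivity|].
    destruct (Nat.eqb_spec z x); congruence. }
  intros (H0 & HG & HL & HR). unfold substG, substL.
  split; [exact H0|split; [|split]]; apply Forall_map.
  - eapply Forall_impl; [|exact HG].
    intros [a b c|a b]; simpl; rewrite !Hs; auto.
  - eapply Forall_impl; [|exact HL].
    intros f; unfold lholds; simpl; rewrite Hs; auto.
  - eapply Forall_impl; [|exact HR].
    intros f; unfold lholds; simpl; rewrite Hs; auto.
Qed.

Lemma rel_neutral_l (M : frame) (h1 h2 : world M) :
  rel neutral h1 h2 <-> h1 = h2.
Proof. rewrite rel_comm. apply rel_identity. Qed.

Ltac split_refutation H :=
  let H0 := fresh "He" in let HG := fresh "HG" in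
  let HL := fresh "HL" in let HR := fresh "HR" in
  pose proof H as (H0 & HG & HL & HR);
  repeat match goal with
  | K : Forall _ (_ :: _) |- _ =>
      let K1 := fresh K in let K2 := fresh K in
      apply Forall_cons_iff in K; destruct K as [K1 K2]
  end; unfold lholds in *; simpl in *.

Ltac build_refutation :=
  split; [assumption|split; [|split]]; repeat apply Forall_cons;
  unfold lholds; simpl; try assumption; try tauto.

(** The valuation is quantified after the derivation, since the induction hypothesis is applied to a
    modified valuation at each rule with fresh labels. *)
Lemma derivable_not_refutable (Var : Type) (b : bool) (M : frame)
    (nu : Var -> world M -> Prop) (G : list atom)
    (Gam Del : list (lformula Var)) :
  splittable M -> cross_split M -> derivable b G Gam Del ->
  forall rho, ~ refutes M nu rho G Gam Del.
Proof.
  intros Hsplit Hcross.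
  induction 1; intros rho Href; split_refutation Href.
  - apply (IHderivable rho). split; [assumption|split; [|split]].
    + rewrite Forall_forall in *. firstorder.
    + eapply Permutation_Forall; [apply Permutation_sym|]; eassumption.
    + eapply Permutation_Forall; [apply Permutation_sym|]; eassumption.
  - contradiction.
  (* The cut formula is true or false at [rho x]; the right or the left premise is refuted
     accordingly. *)
  - apply Forall_app in HG, HL, HR.
    destruct (classic (cforces M nu (rho x) A)).
    + apply (IHderivable2 rho). build_refutation.
    + apply (IHderivable1 rho). build_refutation.
  - assumption.
  - tauto.
  - apply (IHderivable rho). build_refutation.
    rewrite He. apply rel_neutral_l. assumption.
  - congruence.
  - apply (IHderivable rho). build_refutation.
  - destruct (classic (cforces M nu (rho w) A)).
    + apply (IHderivable2 rho). build_refutation.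
    + apply (IHderivable1 rho). build_refutation.
  - destruct (classic (cforces M nu (rho w) A)).
    + apply (IHderivable2 rho). build_refutation.
    + apply (IHderivable1 rho). build_refutation.
  - apply (IHderivable rho). build_refutation.
  - destruct HL0 as (h1 & h2 & Hr & HA & HB).
    destruct (refutes_fresh [h1; h2] H eq_refl Href)
      as (r & Hr1 & Hr2 & Hr3).
    injection Hr1 as Hx Hy.
    assert (Hz : r z = rho z).
    { apply Hr2. unfold sequent_labels. rewrite !in_app_iff. simpl. auto. }
    split_refutation Hr3.
    apply (IHderivable r). build_refutation; rewrite ?Hx, ?Hy, ?Hz; assumption.
  - destruct (classic (cforces M nu (rho x) A)).
    + apply (IHderivable2 rho). build_refutation.
      intro; apply HR0; eauto.
    + apply (IHderivable1 rho). build_refutation.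
  - destruct (classic (cforces M nu (rho x) A)).
    + apply (IHderivable2 rho). build_refutation.
      apply (HL0 (rho x)); [apply rel_comm|]; assumption.
    + apply (IHderivable1 rho). build_refutation.
  - assert (Hw : exists h1 h2, rel (rho z) h1 h2 /\ cforces M nu h1 A /\
                               ~ cforces M nu h2 B).
    { apply NNPP. intro N. apply HR0. intros h1 h2 Hr HA. apply NNPP.
      intro HB. apply N. eauto. }
    destruct Hw as (h1 & h2 & Hr & HA & HB).
    destruct (refutes_fresh [h1; h2] H eq_refl Href)
      as (r & Hr1 & Hr2 & Hr3).
    injection Hr1 as Hx Hy.
    assert (Hz : r z = rho z).
    { apply Hr2. unfold sequent_labels. rewrite !in_app_iff. simpl. auto. }
    split_refutation Hr3.
    apply (IHderivable r). build_refutation; rewrite ?Hx, ?Hy, ?Hz;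
      try assumption. apply rel_comm; assumption.
  - apply (IHderivable rho). build_refutation. apply rel_comm; assumption.
  (* Rule A reads the two compositions in the opposite order to the frame axiom, so both atoms are
     commuted first. *)
  - destruct (rel_assoc M (rho y) (rho v) (rho u) (rho z) (rho x))
      as (h & Hh1 & Hh2).
    { split; apply rel_comm; assumption. }
    destruct (refutes_fresh [h] H eq_refl Href)
      as (r & Hr1 & Hr2 & Hr3).
    injection Hr1 as Hx.
    rewrite rel_comm in Hh1.
    apply (IHderivable r).
    unfold sequent_labels in Hr2; simpl in Hr2.
    split_refutation Hr3.
    build_refutation; rewrite Hx, !Hr2 by auto 8; assumption.
  - apply (IHderivable rho). build_refutation.
    rewrite He. apply rel_identity. reflexivity.
  (* Cancelling (x, y |> x) against (x, epsilon |> x) makes [y] neutral, so the neutral world is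
     also a value for the fresh [w]. *)
  - assert (Hy : rho y = neutral).
    { apply (rel_cancel M (rho x) (rho y) (rho x) neutral).
      split; [assumption|]. apply rel_identity. reflexivity. }
    destruct (refutes_fresh [neutral] H eq_refl Href)
      as (r & Hr1 & Hr2 & Hr3).
    injection Hr1 as Hx.
    apply (IHderivable r).
    unfold sequent_labels in Hr2; simpl in Hr2.
    split_refutation Hr3.
    build_refutation; rewrite Hx, !Hr2, ?Hy by auto 8;
      apply rel_identity; auto.
  - rewrite He in HG0. apply rel_neutral_l in HG0.
    destruct (@refutes_subst Var M nu rho w' w G Gam Del) as (? & ? & ? & ?);
      [congruence|build_refutation|].
    apply (IHderivable rho). build_refutation.
    rewrite He. apply rel_neutral_l. reflexivity.
  - rewrite He in HG0. apply rel_neutral_l in HG0.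
    destruct (@refutes_subst Var M nu rho w' w G Gam Del) as (? & ? & ? & ?);
      [congruence|build_refutation|].
    apply (IHderivable rho). build_refutation.
    rewrite He. apply rel_neutral_l. reflexivity.
  - destruct (@refutes_subst Var M nu rho z w G Gam Del) as (? & ? & ? & ?);
      [eapply rel_functional; eauto|build_refutation|].
    apply (IHderivable rho). build_refutation.
  - destruct (@refutes_subst Var M nu rho y w G Gam Del) as (? & ? & ? & ?);
      [eapply rel_cancel; eauto|build_refutation|].
    apply (IHderivable rho). build_refutation.
  - rewrite He in HG0.
    destruct (Hsplit (rho z) HG0) as (h1 & h2 & Hh1 & Hh2 & Hh).
    destruct (refutes_fresh [h1; h2] H eq_refl Href)
      as (r & Hr1 & Hr2 & Hr3).
    injection Hr1 as Hx Hy.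
    apply (IHderivable r).
    unfold sequent_labels in Hr2; simpl in Hr2.
    split_refutation Hr3.
    build_refutation; rewrite ?Hx, ?Hy, ?Hr2, ?He by auto; assumption.
  - congruence.
  - destruct (classic (rho w = rho LEps)) as [Hw|Hw].
    + apply (IHderivable2 rho). build_refutation.
      rewrite Hw, He. apply rel_identity. reflexivity.
    + apply (IHderivable1 rho). build_refutation.
  - destruct (Hcross _ _ _ _ _ HG0 HG2) as (h1 & h2 & h3 & h4 & K1 & K2 & K3 & K4).
    destruct (refutes_fresh [h1; h2; h3; h4] H eq_refl Href)
      as (r & Hr1 & Hr2 & Hr3).
    injection Hr1 as Hp Hq Hs Ht.
    apply (IHderivable r).
    unfold sequent_labels in Hr2; simpl in Hr2.
    split_refutation Hr3.
    build_refutation; rewrite ?Hp, ?Hq, ?Hs, ?Ht, !Hr2 by auto 8; assumption.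
  (* One splitting is cross-split against itself. *)
  - destruct (Hcross _ _ _ _ _ HG0 HG0) as (h1 & h2 & h3 & h4 & K1 & K2 & K3 & K4).
    destruct (refutes_fresh [h1; h2; h3; h4] H eq_refl Href)
      as (r & Hr1 & Hr2 & Hr3).
    injection Hr1 as Hp Hq Hs Ht.
    apply (IHderivable r).
    unfold sequent_labels in Hr2; simpl in Hr2.
    split_refutation Hr3.
    build_refutation; rewrite ?Hp, ?Hq, ?Hs, ?Ht, !Hr2 by auto 8; assumption.
Qed.

(** * Proof-search states *)

(** An arbitrary function on labels is needed here because [sub] is a composite of many single
    replacements. *)
Definition map_atom (f : label -> label) (a : atom) : atom :=
  match a with
  | ARel a b c => ARel (f a) (f b) (f c)
  | ANeq a b => ANeq (f a) (f b)
  end.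

Definition map_lf (Var : Type) (f : label -> label) (A : lformula Var)
    : lformula Var :=
  (f (fst A), snd A).

(* The sequent under search is [cur; map sub pendL |- map sub pendR].  Labels
   in all other components are never rewritten: the substitutions performed by
   Eq1, Eq2, P and C accumulate in [sub].  [recG], [recL] and [recR] only grow;
   [recL] and [recR] also keep the formulae that were consumed by a rule. *)
Record state (Var : Type) : Type := State {
  recG : list atom;
  cur : list atom;
  recL : list (lformula Var);
  recR : list (lformula Var);
  pendL : list (lformula Var);
  pendR : list (lformula Var);
  sub : label -> label
}.

(* What must have been recorded once the formula has been consumed; [False] for
   the formulae that no rule application removes from the sequent. *)
Definition realL (Var : Type) (S : state Var) (f : lformula Var) : Prop :=
  let (w, A) := f in
  match A with
  | CAnd A B => In (w, A) (recL S) /\ In (w, B) (recL S)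
  | CImp A B => In (w, A) (recR S) \/ In (w, B) (recL S)
  | CEmp => In (ARel LEps w LEps) (recG S)
  | CStar A B => exists x y,
      In (ARel x y w) (recG S) /\ In (x, A) (recL S) /\ In (y, B) (recL S)
  | _ => False
  end.

Definition realR (Var : Type) (S : state Var) (f : lformula Var) : Prop :=
  let (w, A) := f in
  match A with
  | CAnd A B => In (w, A) (recR S) \/ In (w, B) (recR S)
  | CImp A B => In (w, A) (recL S) /\ In (w, B) (recR S)
  | CWand A B => exists x y,
      In (ARel x w y) (recG S) /\ In (x, A) (recL S) /\ In (y, B) (recR S)
  | _ => False
  end.

(** [good_cur] is only an inclusion: the atom that P or C leaves displayed may still contain the
    replaced variable, and then need not be the image of a recorded atom. [good_fixed] guarantees
    variables that [sub] does not move, so that a fresh label bears the same name in the records and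
    in the sequent. *)
Record good (Var : Type) (S : state Var) : Prop := Good {
  good_underivable : ~ derivable false (cur S)
    (map (map_lf (sub S)) (pendL S)) (map (map_lf (sub S)) (pendR S));
  good_cur : forall a, In a (recG S) -> In (map_atom (sub S) a) (cur S);
  good_eps : sub S LEps = LEps;
  good_fixed : exists N, forall k, N <= k -> sub S (LV k) = LV k;
  good_left : forall f, In f (recL S) -> In f (pendL S) \/ realL S f;
  good_right : forall f, In f (recR S) -> In f (pendR S) \/ realR S f
}.

(** Only what obligations mention is compared: pending formulae get consumed and [cur] gets
    rewritten, so neither is monotone. *)
Record le (Var : Type) (S S' : state Var) : Prop := Le {
  le_recG : incl (recG S) (recG S');
  le_recL : incl (recL S) (recL S');
  le_recR : incl (recR S) (recR S');
  le_sub : forall a b, sub S a = sub S b -> sub S' a = sub S' b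
}.

Lemma le_refl (Var : Type) (S : state Var) : le S S.
Proof. split; auto using incl_refl. Qed.

Lemma le_trans (Var : Type) (S1 S2 S3 : state Var) :
  le S1 S2 -> le S2 S3 -> le S1 S3.
Proof.
  intros [] []; split; eauto using incl_tran.
Qed.

Lemma realL_incl (Var : Type) (S S' : state Var) (f : lformula Var) :
  incl (recG S) (recG S') -> incl (recL S) (recL S') ->
  incl (recR S) (recR S') -> realL S f -> realL S' f.
Proof.
  intros HG HL HR. destruct f as [w []]; simpl; auto; try tauto.
  - intros []; auto.
  - intros []; auto.
  - intros (x & y & ? & ? & ?); exists x, y; auto.
Qed.

Lemma realR_incl (Var : Type) (S S' : state Var) (f : lformula Var) :
  incl (recG S) (recG S') -> incl (recL S) (recL S') ->
  incl (recR S) (recR S') -> realR S f -> realR S' f.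
Proof.
  intros HG HL HR. destruct f as [w []]; simpl; auto; try tauto.
  - intros []; auto.
  - intros []; auto.
  - intros (x & y & ? & ? & ?); exists x, y; auto.
Qed.

Lemma derivable_same_atoms (Var : Type) (b : bool) (G G' : list atom)
    (Gam Del : list (lformula Var)) :
  (forall a, In a G <-> In a G') ->
  derivable b G Gam Del -> derivable b G' Gam Del.
Proof.
  intros HG H. eapply d_repr; [exact HG| | |exact H]; apply Permutation_refl.
Qed.

(** Prepares a backward rule application: the principal formula is brought to the front, and an atom
    of [cur S] may be displayed a second time because atoms form a set. *)
Lemma good_underivable_perm (Var : Type) (S : state Var) (G : list atom)
    (l r : list (lformula Var)) :
  good S -> (forall a, In a G <-> In a (cur S)) ->
  Permutation (pendL S) l -> Permutation (pendR S) r ->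
  ~ derivable false G (map (map_lf (sub S)) l) (map (map_lf (sub S)) r).
Proof.
  intros HS HG Hl Hr H. apply (good_underivable HS).
  eapply d_repr; [exact HG| | |exact H];
    apply Permutation_map, Permutation_sym; assumption.
Qed.

Lemma in_perm (A : Type) (x : A) (l : list A) :
  In x l -> exists r, Permutation l (x :: r).
Proof.
  intros H. destruct (in_split _ _ H) as (l1 & l2 & ->).
  exists (l1 ++ l2). apply Permutation_sym, Permutation_middle.
Qed.

(** The common form of all steps that leave [sub] unchanged: [oL], [oR] are consumed, [rL], [rR]
    stay pending, and [nG], [nL], [nR] come in. Realization of the consumed formulae is asked for
    every [S'] recording the new items, because the new state is built only inside the proof. *)
Lemma extend (Var : Type) (S : state Var) (nG : list atom)
    (nL nR oL oR rL rR : list (lformula Var)) :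
  good S ->
  Permutation (pendL S) (oL ++ rL) -> Permutation (pendR S) (oR ++ rR) ->
  (forall S', incl nG (recG S') -> incl nL (recL S') -> incl nR (recR S') ->
     Forall (realL S') oL /\ Forall (realR S') oR) ->
  ~ derivable false (map (map_atom (sub S)) nG ++ cur S)
      (map (map_lf (sub S)) (nL ++ rL)) (map (map_lf (sub S)) (nR ++ rR)) ->
  exists S', le S S' /\ good S' /\
    incl nG (recG S') /\ incl nL (recL S') /\ incl nR (recR S').
Proof.
  intros HS HpL HpR Hreal Hund.
  set (S' := State (nG ++ recG S) (map (map_atom (sub S)) nG ++ cur S)
    (nL ++ recL S) (nR ++ recR S) (nL ++ rL) (nR ++ rR) (sub S)).
  assert (HnG : incl nG (recG S')) by apply incl_appl, incl_refl.
  assert (HnL : incl nL (recL S')) by apply incl_appl, incl_refl.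
  assert (HnR : incl nR (recR S')) by apply incl_appl, incl_refl.
  destruct (Hreal S' HnG HnL HnR) as [HoL HoR].
  rewrite Forall_forall in HoL, HoR.
  assert (Hle : le S S') by (split; simpl; auto using incl_appr, incl_refl).
  exists S'. split; [exact Hle|]. split; [|auto].
  split; simpl.
  - exact Hund.
  - intros a Ha. apply in_or_app. apply in_app_or in Ha. destruct Ha as [Ha|Ha].
    + left. apply in_map, Ha.
    + right. apply (good_cur HS), Ha.
  - apply (good_eps HS).
  - apply (good_fixed HS).
  - intros f Hf. apply in_app_or in Hf. destruct Hf as [Hf|Hf].
    + left. apply in_or_app. auto.
    + destruct (good_left HS _ Hf) as [Hp|Hr].
      * apply (Permutation_in _ HpL), in_app_or in Hp.
        destruct Hp; [right; auto|left; apply in_or_app; auto].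
      * right. apply realL_incl with (S := S); try apply Hle. exact Hr.
  - intros f Hf. apply in_app_or in Hf. destruct Hf as [Hf|Hf].
    + left. apply in_or_app. auto.
    + destruct (good_right HS _ Hf) as [Hp|Hr].
      * apply (Permutation_in _ HpR), in_app_or in Hp.
        destruct Hp; [right; auto|left; apply in_or_app; auto].
      * right. apply realR_incl with (S := S); try apply Hle. exact Hr.
Qed.

Lemma extend_atoms (Var : Type) (S : state Var) (nG : list atom) :
  good S ->
  ~ derivable false (map (map_atom (sub S)) nG ++ cur S)
      (map (map_lf (sub S)) (pendL S)) (map (map_lf (sub S)) (pendR S)) ->
  exists S', le S S' /\ good S' /\ incl nG (recG S').
Proof.
  intros HS Hund.
  destruct (@extend Var S nG [] [] [] [] (pendL S) (pendR S))
    as (S' & ? & ? & ? & _); auto.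
  exists S'; auto.
Qed.

(** A bound rather than one variable, as up to four consecutive variables are drawn from above it.
    Avoiding the sequent itself matters, since [cur] can hold labels outside the image of [sub]. *)
Lemma fresh_bound (Var : Type) (S : state Var) (G : list atom)
    (Gam Del : list (lformula Var)) :
  good S -> exists N, forall k, N <= k ->
    sub S (LV k) = LV k /\ ~ In (LV k) (sequent_labels G Gam Del).
Proof.
  intros HS. destruct (good_fixed HS) as [N HN].
  assert (Hl : forall l, exists M, forall k, M <= k -> ~ In (LV k) l).
  { induction l as [|a l [M HM]]; [exists 0; auto|].
    destruct a as [|z].
    - exists M. intros k Hk [K|K]; [discriminate|apply (HM k); auto].
    - exists (Nat.max M (z + 1)). intros k Hk [K|K].
      + injection K; lia.
      + apply (HM k); [lia|auto]. }
  destruct (Hl (sequent_labels G Gam Del)) as [M HM].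
  exists (Nat.max N M). intros k Hk. split; [apply HN|apply HM]; lia.
Qed.

Lemma fresh_seq (Var : Type) (N n : nat) (G : list atom)
    (Gam Del : list (lformula Var)) :
  (forall k, N <= k -> ~ In (LV k) (sequent_labels G Gam Del)) ->
  fresh (seq N n) G Gam Del.
Proof.
  intros H. split; [apply seq_NoDup|].
  intros x Hx. apply H. apply in_seq in Hx. lia.
Qed.

Ltac solve_same_atoms :=
  let a := fresh "a" in
  intros a; split; simpl; intuition (subst; auto).

(** * Identification of labels *)

(** The replacement is composed after [sub] and the records are left alone, so nothing about
    realized formulae has to be rechecked. [J] is the atom that the premise of the substitution rule
    displays. *)
Lemma identify_var (Var : Type) (S : state Var) (a b : label) (w : LVar)
    (J : atom) :
  good S -> sub S a = LV w ->
  (derivable false (J :: substG (sub S b) w (cur S))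
     (substL (sub S b) w (map (map_lf (sub S)) (pendL S)))
     (substL (sub S b) w (map (map_lf (sub S)) (pendR S))) ->
   derivable false (cur S)
     (map (map_lf (sub S)) (pendL S)) (map (map_lf (sub S)) (pendR S))) ->
  exists S', le S S' /\ good S' /\ sub S' a = sub S' b.
Proof.
  intros HS Ha Hder.
  set (tau := subst_label (sub S b) w).
  set (S' := State (recG S) (J :: substG (sub S b) w (cur S)) (recL S) (recR S)
               (pendL S) (pendR S) (fun l => tau (sub S l))).
  exists S'. split; [|split].
  - split; simpl; auto using incl_refl. intros; f_equal; auto.
  - split; simpl.
    + intros H. apply (good_underivable HS), Hder.
      unfold substL. rewrite !map_map. exact H.
    + intros x Hx. right. apply (good_cur HS) in Hx.
      apply (in_map (subst_atom (sub S b) w)) in Hx.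
      destruct x; exact Hx.
    + rewrite (good_eps HS). reflexivity.
    + destruct (good_fixed HS) as [N HN].
      (* [w] is now moved by the new substitution, so the bound must lie beyond it. *)
      exists (Nat.max N (w + 1)). intros k Hk. rewrite HN by lia.
      unfold tau; simpl. destruct (Nat.eqb_spec k w); [lia|reflexivity].
    + intros f Hf. exact (good_left HS f Hf).
    + intros f Hf. exact (good_right HS f Hf).
  - simpl. rewrite Ha. unfold tau at 1; simpl. rewrite Nat.eqb_refl.
    (* Replacing [w] by [sub S b] inside [sub S b] changes nothing, even when [sub S b] is [w]
       itself. *)
    unfold tau. destruct (sub S b) as [|z]; [reflexivity|].
    simpl. destruct (Nat.eqb_spec z w); reflexivity.
Qed.

(** Epsilon cannot be replaced, so the direction of the substitution depends on which side is a
    variable; two sides that are both epsilon already agree. *)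
Lemma identify (Var : Type) (S : state Var) (a b : label) :
  good S ->
  (forall w c, sub S a = LV w /\ sub S b = c \/ sub S b = LV w /\ sub S a = c ->
   exists J, forall Gam Del : list (lformula Var),
     derivable false (J :: substG c w (cur S)) (substL c w Gam) (substL c w Del)
     -> derivable false (cur S) Gam Del) ->
  exists S', le S S' /\ good S' /\ sub S' a = sub S' b.
Proof.
  intros HS H.
  destruct (sub S a) as [|w] eqn:Ha.
  - destruct (sub S b) as [|w] eqn:Hb.
    + exists S. split; [apply le_refl|split; [exact HS|congruence]].
    + destruct (H w LEps) as [J HJ]; [auto|].
      destruct (@identify_var Var S b a w J) as (S' & ? & ? & ?); auto.
      { rewrite Ha. apply HJ. }
      exists S'; auto.
  - destruct (H w (sub S b)) as [J HJ]; [auto|].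
    apply identify_var with (w := w) (J := J); auto.
Qed.

Lemma identify_identity (Var : Type) (S : state Var) (e a b : label) :
  good S -> In (ARel e a b) (recG S) -> sub S e = LEps ->
  exists S', le S S' /\ good S' /\ sub S' a = sub S' b.
Proof.
  intros HS Hin He. apply (good_cur HS) in Hin; simpl in Hin. rewrite He in Hin.
  apply identify; [exact HS|].
  (* Eq1 replaces a variable in the middle of the atom, Eq2 one at its end; the two orientations of
     [Hwc] select between them. *)
  intros w c Hwc. exists (ARel LEps c c). intros Gam Del H.
  destruct Hwc as [[Ha Hb]|[Hb Ha]]; rewrite Ha, Hb in Hin.
  - apply d_Eq1 in H. revert H. apply derivable_same_atoms. solve_same_atoms.
  - apply d_Eq2 in H. revert H. apply derivable_same_atoms. solve_same_atoms.
Qed.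

(** P serves both orientations, because either of the two atoms can be the one whose result is
    kept. *)
Lemma identify_functional (Var : Type) (S : state Var)
    (x y z x' y' z' : label) :
  good S -> In (ARel x y z) (recG S) -> In (ARel x' y' z') (recG S) ->
  sub S x = sub S x' -> sub S y = sub S y' ->
  exists S', le S S' /\ good S' /\ sub S' z = sub S' z'.
Proof.
  intros HS Hin Hin' Hx Hy.
  apply (good_cur HS) in Hin, Hin'; simpl in Hin, Hin'.
  rewrite <- Hx, <- Hy in Hin'.
  apply identify; [exact HS|].
  intros w c Hwc. exists (ARel (sub S x) (sub S y) c). intros Gam Del H.
  apply d_P in H.
  destruct Hwc as [[Ha Hb]|[Hb Ha]]; rewrite Ha in Hin; rewrite Hb in Hin';
    revert H; apply derivable_same_atoms; solve_same_atoms.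
Qed.

Lemma identify_cancel (Var : Type) (S : state Var)
    (x y z x' y' z' : label) :
  good S -> In (ARel x y z) (recG S) -> In (ARel x' y' z') (recG S) ->
  sub S x = sub S x' -> sub S z = sub S z' ->
  exists S', le S S' /\ good S' /\ sub S' y = sub S' y'.
Proof.
  intros HS Hin Hin' Hx Hy.
  apply (good_cur HS) in Hin, Hin'; simpl in Hin, Hin'.
  rewrite <- Hx, <- Hy in Hin'.
  apply identify; [exact HS|].
  intros w c Hwc. exists (ARel (sub S x) c (sub S z)). intros Gam Del H.
  apply d_C in H.
  destruct Hwc as [[Ha Hb]|[Hb Ha]]; rewrite Ha in Hin; rewrite Hb in Hin';
    revert H; apply derivable_same_atoms; solve_same_atoms.
Qed.

(** * Single expansion steps *)

Lemma step_U (Var : Type) (S : state Var) (l : label) :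
  good S -> exists S', le S S' /\ good S' /\ In (ARel l LEps l) (recG S').
Proof.
  intros HS.
  destruct (@extend_atoms Var S [ARel l LEps l] HS) as (S' & ? & ? & Hi).
  - intros H. simpl in H. rewrite (good_eps HS) in H.
    exact (good_underivable HS (d_U H)).
  - exists S'. split; [|split]; auto. apply Hi; simpl; auto.
Qed.

Lemma step_EM (Var : Type) (S : state Var) (l : label) :
  good S -> exists S', le S S' /\ good S' /\
    (In (ANeq l LEps) (recG S') \/ In (ARel LEps l LEps) (recG S')).
Proof.
  intros HS.
  (* Branching is resolved by derivability: if the first premise is derivable, the second cannot be,
     as the conclusion is not. *)
  destruct (classic (derivable false (ANeq (sub S l) LEps :: cur S)
    (map (map_lf (sub S)) (pendL S)) (map (map_lf (sub S)) (pendR S))))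
    as [H1|H1].
  - destruct (@extend_atoms Var S [ARel LEps l LEps] HS)
      as (S' & ? & ? & Hi).
    + intros H2. simpl in H2. rewrite (good_eps HS) in H2.
      exact (good_underivable HS (d_EM H1 H2)).
    + exists S'. split; [|split]; auto. right. apply Hi; simpl; auto.
  - destruct (@extend_atoms Var S [ANeq l LEps] HS) as (S' & ? & ? & Hi).
    + simpl. rewrite (good_eps HS). exact H1.
    + exists S'. split; [|split]; auto. left. apply Hi; simpl; auto.
Qed.

Lemma step_E (Var : Type) (S : state Var) (x y z : label) :
  good S -> In (ARel x y z) (recG S) ->
  exists S', le S S' /\ good S' /\ In (ARel y x z) (recG S').
Proof.
  intros HS Hin. apply (good_cur HS) in Hin; simpl in Hin.
  destruct (@extend_atoms Var S [ARel y x z] HS) as (S' & ? & ? & Hi).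
  - intros H. apply (good_underivable HS).
    (* The displayed atom is put in front of [cur S], which already contains it; both conversions
       are equalities of sets. *)
    eapply derivable_same_atoms;
      [|apply (@d_E Var false (cur S)) with (x := sub S x) (y := sub S y)
          (z := sub S z); eapply derivable_same_atoms; [|exact H]];
      solve_same_atoms.
  - exists S'. split; [|split]; auto. apply Hi; simpl; auto.
Qed.

Lemma step_S (Var : Type) (S : state Var) (z : label) :
  good S -> In (ANeq z LEps) (recG S) ->
  exists S', le S S' /\ good S' /\ exists x y, In (ARel x y z) (recG S') /\
    In (ANeq x LEps) (recG S') /\ In (ANeq y LEps) (recG S').
Proof.
  intros HS Hin. apply (good_cur HS) in Hin; simpl in Hin.
  rewrite (good_eps HS) in Hin.
  destruct (@fresh_bound Var S (ANeq (sub S z) LEps :: cur S)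
    (map (map_lf (sub S)) (pendL S)) (map (map_lf (sub S)) (pendR S)) HS)
    as (N & HN).
  destruct (@extend_atoms Var S [ARel (LV N) (LV (1 + N)) z;
    ANeq (LV N) LEps; ANeq (LV (1 + N)) LEps] HS) as (S' & ? & ? & Hi).
  - intros H. cbn [map map_atom app] in H.
    (* The new variables are fixed by [sub], so the atoms added to the sequent are literally those
       of the rule. *)
    rewrite (good_eps HS), !(fun k Hk => proj1 (HN k Hk)) in H by lia.
    apply (good_underivable HS).
    eapply derivable_same_atoms;
      [|apply (@d_S Var false (cur S)) with (x := N) (y := 1 + N)
          (z := sub S z); [apply (@fresh_seq Var N 2); apply HN|
        eapply derivable_same_atoms; [|exact H]]];
      solve_same_atoms.
  - exists S'. split; [|split]; auto. exists (LV N), (LV (1 + N)).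
    repeat split; apply Hi; simpl; auto.
Qed.

(** The recorded atoms share a label only up to [sub], which is enough because the rule is applied
    to their images. The new atoms are nevertheless recorded under the original names. *)
Lemma step_A (Var : Type) (S : state Var) (x y z u v x' : label) :
  good S -> In (ARel x y z) (recG S) -> In (ARel u v x') (recG S) ->
  sub S x = sub S x' ->
  exists S', le S S' /\ good S' /\
    exists w, In (ARel u w z) (recG S') /\ In (ARel y v w) (recG S').
Proof.
  intros HS Hin Hin' Hx.
  apply (good_cur HS) in Hin, Hin'; simpl in Hin, Hin'.
  rewrite <- Hx in Hin'.
  set (G := ARel (sub S x) (sub S y) (sub S z) ::
            ARel (sub S u) (sub S v) (sub S x) :: cur S).
  destruct (@fresh_bound Var S G
    (map (map_lf (sub S)) (pendL S)) (map (map_lf (sub S)) (pendR S)) HS)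
    as (N & HN).
  destruct (@extend_atoms Var S [ARel u (LV N) z; ARel y v (LV N)] HS)
    as (S' & ? & ? & Hi).
  - intros H. cbn [map map_atom app] in H.
    rewrite !(fun k Hk => proj1 (HN k Hk)) in H by lia.
    apply (good_underivable HS).
    eapply derivable_same_atoms;
      [|apply (@d_A Var false (cur S)) with (x := sub S x) (y := sub S y)
          (z := sub S z) (u := sub S u) (v := sub S v) (w := N);
        [apply (@fresh_seq Var N 1); apply HN|
         eapply derivable_same_atoms; [|exact H]]];
      solve_same_atoms.
  - exists S'. split; [|split]; auto. exists (LV N).
    repeat split; apply Hi; simpl; auto.
Qed.

Lemma step_CS (Var : Type) (S : state Var) (x y z u v z' : label) :
  good S -> In (ARel x y z) (recG S) -> In (ARel u v z') (recG S) ->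
  sub S z = sub S z' ->
  exists S', le S S' /\ good S' /\ exists p q s t,
    In (ARel p q x) (recG S') /\ In (ARel s t y) (recG S') /\
    In (ARel p s u) (recG S') /\ In (ARel q t v) (recG S').
Proof.
  intros HS Hin Hin' Hx.
  apply (good_cur HS) in Hin, Hin'; simpl in Hin, Hin'.
  rewrite <- Hx in Hin'.
  set (G := ARel (sub S x) (sub S y) (sub S z) ::
            ARel (sub S u) (sub S v) (sub S z) :: cur S).
  destruct (@fresh_bound Var S G
    (map (map_lf (sub S)) (pendL S)) (map (map_lf (sub S)) (pendR S)) HS)
    as (N & HN).
  destruct (@extend_atoms Var S
    [ARel (LV N) (LV (1 + N)) x; ARel (LV N) (LV (2 + N)) u;
     ARel (LV (2 + N)) (LV (3 + N)) y; ARel (LV (1 + N)) (LV (3 + N)) v] HS)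
    as (S' & ? & ? & Hi).
  - intros H. cbn [map map_atom app] in H.
    rewrite !(fun k Hk => proj1 (HN k Hk)) in H by lia.
    apply (good_underivable HS).
    eapply derivable_same_atoms;
      [|apply (@d_CS Var false (cur S)) with (x := sub S x) (y := sub S y)
          (z := sub S z) (u := sub S u) (v := sub S v)
          (p := N) (q := 1 + N) (s := 2 + N) (t := 3 + N);
        [apply (@fresh_seq Var N 4); apply HN|
         eapply derivable_same_atoms; [|exact H]]];
      solve_same_atoms.
  - exists S'. split; [|split]; auto.
    exists (LV N), (LV (1 + N)), (LV (2 + N)), (LV (3 + N)).
    repeat split; apply Hi; simpl; auto.
Qed.

(** A wand on the left survives its own rule and is treated separately, once for each matching atom;
    the same holds for a star on the right. *)
Definition consumedL (Var : Type) (f : lformula Var) : Prop :=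
  match snd f with
  | CAnd _ _ | CImp _ _ | CEmp | CStar _ _ => True
  | _ => False
  end.

Definition consumedR (Var : Type) (f : lformula Var) : Prop :=
  match snd f with
  | CAnd _ _ | CImp _ _ | CWand _ _ => True
  | _ => False
  end.

Ltac finish_extend :=
  match goal with
  | K : exists S', _ |- _ =>
      let S' := fresh "S'" in let Hle := fresh "Hle" in
      let Hg := fresh "Hg" in let HG := fresh "HG" in
      let HL := fresh "HL" in let HR := fresh "HR" in
      destruct K as (S' & Hle & Hg & HG & HL & HR);
      exists S'; split; [exact Hle|split; [exact Hg|]]
  end.

Ltac solve_real :=
  let S' := fresh "S'" in let HG := fresh "HG" in
  let HL := fresh "HL" in let HR := fresh "HR" in
  intros S' HG HL HR; split;
  repeat apply Forall_cons; try apply Forall_nil; simpl; auto with datatypes.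

(** If the formula is no longer pending, it was consumed earlier and is realized already; otherwise
    its left rule, read backwards, consumes it now. *)
Lemma step_left (Var : Type) (S : state Var) (f : lformula Var) :
  good S -> In f (recL S) -> consumedL f ->
  exists S', le S S' /\ good S' /\ realL S' f.
Proof.
  intros HS Hin Hc.
  destruct (good_left HS f Hin) as [Hp|Hr];
    [|exists S; auto using le_refl].
  destruct (in_perm _ _ Hp) as [r Hperm]. clear Hin Hp.
  assert (Hund : ~ derivable false (cur S)
    (map (map_lf (sub S)) (f :: r)) (map (map_lf (sub S)) (pendR S))).
  { apply good_underivable_perm; auto; tauto. }
  destruct f as [w A]; destruct A as [p| | |A B|A B| |A B|A B];
    try contradiction.
  - assert (K : exists S', le S S' /\ good S' /\ incl [] (recG S') /\
      incl [(w, A); (w, B)] (recL S') /\ incl [] (recR S')).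
    { apply extend with (oL := [(w, CAnd A B)]) (oR := []) (rL := r)
        (rR := pendR S); auto; [solve_real|].
      intros H. apply Hund. apply d_AndL. exact H. }
    finish_extend. simpl; auto with datatypes.
  - destruct (classic (derivable false (cur S) (map (map_lf (sub S)) r)
      (map (map_lf (sub S)) ((w, A) :: pendR S)))) as [H1|H1].
    + assert (K : exists S', le S S' /\ good S' /\ incl [] (recG S') /\
        incl [(w, B)] (recL S') /\ incl [] (recR S')).
      { apply extend with (oL := [(w, CImp A B)]) (oR := []) (rL := r)
          (rR := pendR S); auto; [solve_real|].
        intros H2. apply Hund.
        apply d_ImpL; [exact H1|exact H2]. }
      finish_extend. simpl; auto with datatypes.
    + assert (K : exists S', le S S' /\ good S' /\ incl [] (recG S') /\
        incl [] (recL S') /\ incl [(w, A)] (recR S')).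
      { apply extend with (oL := [(w, CImp A B)]) (oR := []) (rL := r)
          (rR := pendR S); auto; solve_real. }
      finish_extend. simpl; auto with datatypes.
  - assert (K : exists S', le S S' /\ good S' /\
      incl [ARel LEps w LEps] (recG S') /\
      incl [] (recL S') /\ incl [] (recR S')).
    { apply extend with (oL := [(w, CEmp)]) (oR := []) (rL := r)
        (rR := pendR S); auto; [solve_real|].
      intros H. apply Hund. apply d_EmpL.
      simpl in H. rewrite (good_eps HS) in H. exact H. }
    finish_extend. simpl; auto with datatypes.
  - destruct (@fresh_bound Var S (cur S)
      (map (map_lf (sub S)) ((w, CStar A B) :: r))
      (map (map_lf (sub S)) (pendR S)) HS) as (N & HN).
    assert (K : exists S', le S S' /\ good S' /\
      incl [ARel (LV N) (LV (1 + N)) w] (recG S') /\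
      incl [(LV N, A); (LV (1 + N), B)] (recL S') /\ incl [] (recR S')).
    { apply extend with (oL := [(w, CStar A B)]) (oR := []) (rL := r)
        (rR := pendR S); auto.
      - intros S' HG HL HR. split; repeat apply Forall_cons; try apply Forall_nil.
        exists (LV N), (LV (1 + N)). auto with datatypes.
      - intros H. apply Hund.
        apply d_StarL with (x := N) (y := 1 + N).
        + apply (@fresh_seq Var N 2). apply HN.
        + cbn [map map_atom map_lf app fst snd] in H. unfold map_lf at 1 2 in H.
          cbn [fst snd] in H.
          rewrite !(fun k Hk => proj1 (HN k Hk)) in H by lia. exact H. }
    finish_extend. exists (LV N), (LV (1 + N)). auto with datatypes.
Qed.

Lemma step_right (Var : Type) (S : state Var) (f : lformula Var) :
  good S -> In f (recR S) -> consumedR f ->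
  exists S', le S S' /\ good S' /\ realR S' f.
Proof.
  intros HS Hin Hc.
  destruct (good_right HS f Hin) as [Hp|Hr];
    [|exists S; auto using le_refl].
  destruct (in_perm _ _ Hp) as [r Hperm]. clear Hin Hp.
  assert (Hund : ~ derivable false (cur S)
    (map (map_lf (sub S)) (pendL S)) (map (map_lf (sub S)) (f :: r))).
  { apply good_underivable_perm; auto; tauto. }
  destruct f as [w A]; destruct A as [p| | |A B|A B| |A B|A B];
    try contradiction.
  - destruct (classic (derivable false (cur S) (map (map_lf (sub S)) (pendL S))
      (map (map_lf (sub S)) ((w, A) :: r)))) as [H1|H1].
    + assert (K : exists S', le S S' /\ good S' /\ incl [] (recG S') /\
        incl [] (recL S') /\ incl [(w, B)] (recR S')).
      { apply extend with (oL := []) (oR := [(w, CAnd A B)])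
          (rL := pendL S) (rR := r); auto; [solve_real|].
        intros H2. apply Hund.
        apply d_AndR; [exact H1|exact H2]. }
      finish_extend. simpl; auto with datatypes.
    + assert (K : exists S', le S S' /\ good S' /\ incl [] (recG S') /\
        incl [] (recL S') /\ incl [(w, A)] (recR S')).
      { apply extend with (oL := []) (oR := [(w, CAnd A B)])
          (rL := pendL S) (rR := r); auto; solve_real. }
      finish_extend. simpl; auto with datatypes.
  - assert (K : exists S', le S S' /\ good S' /\ incl [] (recG S') /\
      incl [(w, A)] (recL S') /\ incl [(w, B)] (recR S')).
    { apply extend with (oL := []) (oR := [(w, CImp A B)])
        (rL := pendL S) (rR := r); auto; [solve_real|].
      intros H. apply Hund. apply d_ImpR. exact H. }
    finish_extend. simpl; auto with datatypes.
  - destruct (@fresh_bound Var S (cur S) (map (map_lf (sub S)) (pendL S))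
      (map (map_lf (sub S)) ((w, CWand A B) :: r)) HS) as (N & HN).
    assert (K : exists S', le S S' /\ good S' /\
      incl [ARel (LV N) w (LV (1 + N))] (recG S') /\
      incl [(LV N, A)] (recL S') /\ incl [(LV (1 + N), B)] (recR S')).
    { apply extend with (oL := []) (oR := [(w, CWand A B)])
        (rL := pendL S) (rR := r); auto.
      - intros S' HG HL HR. split; repeat apply Forall_cons; try apply Forall_nil.
        exists (LV N), (LV (1 + N)). auto with datatypes.
      - intros H. apply Hund.
        apply d_WandR with (x := N) (y := 1 + N).
        + apply (@fresh_seq Var N 2). apply HN.
        + cbn [map map_atom map_lf app fst snd] in H. unfold map_lf at 1 3 in H.
          cbn [fst snd] in H.
          rewrite !(fun k Hk => proj1 (HN k Hk)) in H by lia. exact H. }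
    finish_extend. exists (LV N), (LV (1 + N)). auto with datatypes.
Qed.

(** For these formulae [realL] is [False], so only being pending remains. This makes them available
    to axioms and to the left wand rule at any later stage. *)
Lemma persistentL (Var : Type) (S : state Var) (f : lformula Var) :
  good S -> ~ consumedL f -> In f (recL S) -> In f (pendL S).
Proof.
  intros HS Hc Hin. destruct (good_left HS f Hin) as [H|H]; [exact H|].
  exfalso. destruct f as [w []]; (exact H || exact (Hc I)).
Qed.

Lemma persistentR (Var : Type) (S : state Var) (f : lformula Var) :
  good S -> ~ consumedR f -> In f (recR S) -> In f (pendR S).
Proof.
  intros HS Hc Hin. destruct (good_right HS f Hin) as [H|H]; [exact H|].
  exfalso. destruct f as [w []]; (exact H || exact (Hc I)).
Qed.

(** The rule keeps its principal formula, so nothing is consumed: [oR] is empty and the star goes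
    back among the pending formulae, ready for further atoms. *)
Lemma step_star_right (Var : Type) (S : state Var) (x y z z' : label)
    (A B : cformula Var) :
  good S -> In (ARel x y z) (recG S) -> In (z', CStar A B) (recR S) ->
  sub S z = sub S z' ->
  exists S', le S S' /\ good S' /\ (In (x, A) (recR S') \/ In (y, B) (recR S')).
Proof.
  intros HS Hin Hf Hz.
  apply (good_cur HS) in Hin; simpl in Hin.
  apply (persistentR _ HS) in Hf; [|exact (fun H => H)].
  destruct (in_perm _ _ Hf) as [r Hperm].
  set (Gam := map (map_lf (sub S)) (pendL S)).
  set (Del := map (map_lf (sub S)) r).
  assert (Hund : forall A', A' = (x, A) \/ A' = (y, B) ->
    ~ derivable false (cur S) Gam
        (map_lf (sub S) A' :: (sub S z, CStar A B) :: Del) ->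
    exists S', le S S' /\ good S' /\ incl [] (recG S') /\ incl [] (recL S') /\
      incl [A'] (recR S')).
  { intros A' _ H. apply extend with (oL := []) (oR := []) (rL := pendL S)
      (rR := (z', CStar A B) :: r); auto.
    rewrite Hz in H. exact H. }
  destruct (classic (derivable false (cur S) Gam
      (map_lf (sub S) (x, A) :: (sub S z, CStar A B) :: Del))) as [H1|H1].
  - destruct (classic (derivable false (cur S) Gam
      (map_lf (sub S) (y, B) :: (sub S z, CStar A B) :: Del))) as [H2|H2].
    + exfalso.
      apply (@good_underivable_perm Var S
        (ARel (sub S x) (sub S y) (sub S z) :: cur S) _ _ HS)
        with (2 := Permutation_refl _) (3 := Hperm); [solve_same_atoms|].
      simpl. unfold map_lf at 2; simpl. rewrite <- Hz.
      apply d_StarR; (eapply derivable_same_atoms; [|eassumption]);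
        solve_same_atoms.
    + specialize (Hund _ (or_intror eq_refl) H2). finish_extend.
      auto with datatypes.
  - specialize (Hund _ (or_introl eq_refl) H1). finish_extend.
    auto with datatypes.
Qed.

Lemma step_wand_left (Var : Type) (S : state Var) (x y z y' : label)
    (A B : cformula Var) :
  good S -> In (ARel x y z) (recG S) -> In (y', CWand A B) (recL S) ->
  sub S y = sub S y' ->
  exists S', le S S' /\ good S' /\ (In (x, A) (recR S') \/ In (z, B) (recL S')).
Proof.
  intros HS Hin Hf Hy.
  apply (good_cur HS) in Hin; simpl in Hin.
  apply (persistentL _ HS) in Hf; [|exact (fun H => H)].
  destruct (in_perm _ _ Hf) as [r Hperm].
  set (Gam := map (map_lf (sub S)) r).
  set (Del := map (map_lf (sub S)) (pendR S)).
  destruct (classic (derivable false (cur S) ((sub S y, CWand A B) :: Gam)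
      (map_lf (sub S) (x, A) :: Del))) as [H1|H1].
  - destruct (classic (derivable false (cur S)
      ((sub S y, CWand A B) :: map_lf (sub S) (z, B) :: Gam) Del)) as [H2|H2].
    + exfalso.
      apply (@good_underivable_perm Var S
        (ARel (sub S x) (sub S y) (sub S z) :: cur S) _ _ HS)
        with (2 := Hperm) (3 := Permutation_refl _); [solve_same_atoms|].
      simpl. unfold map_lf at 1; simpl. rewrite <- Hy.
      apply d_WandL; (eapply derivable_same_atoms; [|eassumption]);
        solve_same_atoms.
    + assert (K : exists S', le S S' /\ good S' /\ incl [] (recG S') /\
        incl [(z, B)] (recL S') /\ incl [] (recR S')).
      { apply extend with (oL := []) (oR := []) (rR := pendR S)
          (rL := (y', CWand A B) :: r); auto.
        intros H. apply H2. rewrite Hy.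
        (* [extend] puts the new formula first, while the rule keeps the wand in front of it. *)
        eapply d_repr; [intros; reflexivity|apply perm_swap|
          apply Permutation_refl|exact H]. }
      finish_extend. auto with datatypes.
  - assert (K : exists S', le S S' /\ good S' /\ incl [] (recG S') /\
      incl [] (recL S') /\ incl [(x, A)] (recR S')).
    { apply extend with (oL := []) (oR := []) (rR := pendR S)
        (rL := (y', CWand A B) :: r); auto.
      rewrite Hy in H1. exact H1. }
    finish_extend. auto with datatypes.
Qed.

(** * Saturation *)

(** Reachability is required from every good extension of [S]: when several obligations are met in
    turn, each starts where the previous one ended. *)
Definition forceable (Var : Type) (S : state Var) (Q : state Var -> Prop)
    : Prop :=
  (forall S1 S2, le S1 S2 -> Q S1 -> Q S2) /\
  (forall S', le S S' -> good S' -> exists S'', le S' S'' /\ good S'' /\ Q S'').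

Lemma forceable_and (Var : Type) (S : state Var) (P Q : state Var -> Prop) :
  forceable S P -> forceable S Q -> forceable S (fun S' => P S' /\ Q S').
Proof.
  intros [HP1 HP2] [HQ1 HQ2]. split.
  - intros S1 S2 Hle []; split; eauto.
  - intros S1 Hle Hg.
    destruct (HP2 S1 Hle Hg) as (S2 & Hle2 & Hg2 & H2).
    destruct (HQ2 S2 (le_trans Hle Hle2) Hg2) as (S3 & Hle3 & Hg3 & H3).
    exists S3. split; [eapply le_trans; eassumption|eauto].
Qed.

Lemma forceable_const (Var : Type) (S : state Var) (P : Prop) :
  P -> forceable S (fun _ => P).
Proof.
  intros H. split; [auto|]. intros S' _ Hg. exists S'. auto using le_refl.
Qed.

(** The condition [C] does not depend on the moving state. A condition that could become true later
    would destroy monotonicity, so tasks are conditioned on the equations at the start of the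
    stage. *)
Lemma forceable_impl (Var : Type) (S : state Var) (C : Prop)
    (Q : state Var -> Prop) :
  (C -> forceable S Q) -> forceable S (fun S' => C -> Q S').
Proof.
  intros H. split.
  - intros S1 S2 Hle HQ c. destruct (H c) as [Hm _]. eauto.
  - intros S' Hle Hg. destruct (classic C) as [c|c].
    + destruct (H c) as [_ Hf]. destruct (Hf S' Hle Hg) as (S2 & ? & ? & ?).
      exists S2. auto.
    + exists S'. split; [apply le_refl|]. tauto.
Qed.

Lemma forceable_all (Var X : Type) (S : state Var) (l : list X)
    (Q : X -> state Var -> Prop) :
  (forall x, In x l -> forceable S (Q x)) ->
  forceable S (fun S' => forall x, In x l -> Q x S').
Proof.
  induction l as [|x l IH]; intros H.
  - split; [intros S1 S2 _ _ y []|]. intros S' _ Hg. exists S'.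
    split; [apply le_refl|split; [exact Hg|intros y []]].
  - destruct (@forceable_and Var S (Q x)
      (fun S' => forall x, In x l -> Q x S')) as [Hm Hf].
    { apply H; simpl; auto. }
    { apply IH. intros; apply H; simpl; auto. }
    split.
    + intros S1 S2 Hle HQ y Hy. refine (proj1 (H y Hy) S1 S2 Hle (HQ y Hy)).
    + intros S' Hle Hg. destruct (Hf S' Hle Hg) as (S2 & ? & ? & Hx & Hl).
      exists S2. split; [assumption|split; [assumption|]].
      intros y [<-|Hy]; auto.
Qed.

Definition label_task (Var : Type) (l : label) (S' : state Var) : Prop :=
  In (ARel l LEps l) (recG S') /\
  (In (ANeq l LEps) (recG S') \/ In (ARel LEps l LEps) (recG S')).

(** The identity clause must apply to any [x] identified with epsilon, whatever its name. For
    inequalities the literal [LEps] suffices, since EM and S record only inequalities of that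
    shape. *)
Definition atom_task (Var : Type) (S : state Var) (a : atom) (S' : state Var)
    : Prop :=
  match a with
  | ARel x y z =>
      In (ARel y x z) (recG S') /\
      (sub S x = sub S LEps -> sub S' y = sub S' z)
  | ANeq z z' =>
      z' = LEps -> exists x y, In (ARel x y z) (recG S') /\
        In (ANeq x LEps) (recG S') /\ In (ANeq y LEps) (recG S')
  end.

(** The clauses correspond to A, P, C and CS, in this order. The two atoms may coincide. *)
Definition atom_pair_task (Var : Type) (S : state Var) (a b : atom)
    (S' : state Var) : Prop :=
  match a, b with
  | ARel x y z, ARel u v w =>
      (sub S x = sub S w -> exists k,
         In (ARel u k z) (recG S') /\ In (ARel y v k) (recG S')) /\
      (sub S x = sub S u /\ sub S y = sub S v -> sub S' z = sub S' w) /\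
      (sub S x = sub S u /\ sub S z = sub S w -> sub S' y = sub S' v) /\
      (sub S z = sub S w -> exists p q s t,
         In (ARel p q x) (recG S') /\ In (ARel s t y) (recG S') /\
         In (ARel p s u) (recG S') /\ In (ARel q t v) (recG S'))
  | _, _ => True
  end.

Definition star_task (Var : Type) (S : state Var) (a : atom)
    (f : lformula Var) (S' : state Var) : Prop :=
  match a, f with
  | ARel x y z, (w, CStar A B) =>
      sub S z = sub S w -> In (x, A) (recR S') \/ In (y, B) (recR S')
  | _, _ => True
  end.

Definition wand_task (Var : Type) (S : state Var) (a : atom)
    (f : lformula Var) (S' : state Var) : Prop :=
  match a, f with
  | ARel x y z, (w, CWand A B) =>
      sub S y = sub S w -> In (x, A) (recR S') \/ In (z, B) (recL S')
  | _, _ => True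
  end.

(** U and EM apply to every label, occurring or not. Serving only epsilon and the variable [n] keeps
    stage [n] finite, while each label still gets its turn. *)
Definition saturates (Var : Type) (n : nat) (S S' : state Var) : Prop :=
  (forall l, In l [LEps; LV n] -> label_task l S') /\
  (forall a, In a (recG S) -> atom_task S a S') /\
  (forall a, In a (recG S) -> forall b, In b (recG S) ->
     atom_pair_task S a b S') /\
  (forall f, In f (recL S) -> consumedL f -> realL S' f) /\
  (forall f, In f (recR S) -> consumedR f -> realR S' f) /\
  (forall a, In a (recG S) -> forall f, In f (recR S) -> star_task S a f S') /\
  (forall a, In a (recG S) -> forall f, In f (recL S) -> wand_task S a f S').

Lemma forceable_saturates (Var : Type) (n : nat) (S : state Var) :
  forceable S (saturates n S).
Proof.
  repeat apply forceable_and.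
  - apply forceable_all. intros l _. apply forceable_and; split.
    + intros S1 S2 Hle H. apply Hle, H.
    + intros S' _ Hg. apply step_U, Hg.
    + intros S1 S2 Hle [H|H]; [left|right]; apply Hle, H.
    + intros S' _ Hg. apply step_EM, Hg.
  - apply forceable_all. intros [x y z|z z'] Ha.
    + apply forceable_and; [|apply forceable_impl; intros He]; split.
      * intros S1 S2 Hle H. apply Hle, H.
      * intros S' Hle Hg. apply step_E; [exact Hg|apply Hle, Ha].
      * intros S1 S2 Hle H. apply Hle, H.
      * intros S' Hle Hg.
        apply identify_identity with (e := x); [exact Hg|apply Hle, Ha|].
        rewrite <- (good_eps Hg). apply Hle, He.
    + apply forceable_impl; intros ->; split.
      * intros S1 S2 Hle (x & y & ? & ? & ?). exists x, y.
        repeat split; apply Hle; assumption.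
      * intros S' Hle Hg. apply step_S; [exact Hg|apply Hle, Ha].
  - apply forceable_all. intros a Ha. apply forceable_all. intros b Hb.
    destruct a as [x y z|]; [|apply forceable_const; exact I].
    destruct b as [u v w|]; [|apply forceable_const; exact I].
    repeat apply forceable_and; apply forceable_impl; intros He; split.
    + intros S1 S2 Hle (k & ? & ?). exists k. split; apply Hle; assumption.
    + intros S' Hle Hg. apply step_A with (x := x) (x' := w);
        [exact Hg|apply Hle, Ha|apply Hle, Hb|apply Hle, He].
    + intros S1 S2 Hle H. apply Hle, H.
    + intros S' Hle Hg.
      apply identify_functional with (x := x) (y := y) (x' := u) (y' := v);
        [exact Hg|apply Hle, Ha|apply Hle, Hb|apply Hle, He|apply Hle, He].
    + intros S1 S2 Hle H. apply Hle, H.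
    + intros S' Hle Hg.
      apply identify_cancel with (x := x) (z := z) (x' := u) (z' := w);
        [exact Hg|apply Hle, Ha|apply Hle, Hb|apply Hle, He|apply Hle, He].
    + intros S1 S2 Hle (p & q & s & t & ? & ? & ? & ?). exists p, q, s, t.
      repeat split; apply Hle; assumption.
    + intros S' Hle Hg. apply step_CS with (z := z) (z' := w);
        [exact Hg|apply Hle, Ha|apply Hle, Hb|apply Hle, He].
  - apply forceable_all. intros f Hf. apply forceable_impl; intros Hc. split.
    + intros S1 S2 Hle. apply realL_incl; apply Hle.
    + intros S' Hle Hg. apply step_left; [exact Hg|apply Hle, Hf|exact Hc].
  - apply forceable_all. intros f Hf. apply forceable_impl; intros Hc. split.
    + intros S1 S2 Hle. apply realR_incl; apply Hle.
    + intros S' Hle Hg. apply step_right; [exact Hg|apply Hle, Hf|exact Hc].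
  - apply forceable_all. intros a Ha. apply forceable_all. intros [w A] Hf.
    destruct a as [x y z|]; [|apply forceable_const; exact I].
    destruct A; try (apply forceable_const; exact I).
    apply forceable_impl; intros He. split.
    + intros S1 S2 Hle [H|H]; [left|right]; apply Hle, H.
    + intros S' Hle Hg. eapply step_star_right;
        [exact Hg|apply Hle, Ha|apply Hle, Hf|apply Hle, He].
  - apply forceable_all. intros a Ha. apply forceable_all. intros [w A] Hf.
    destruct a as [x y z|]; [|apply forceable_const; exact I].
    destruct A; try (apply forceable_const; exact I).
    apply forceable_impl; intros He. split.
    + intros S1 S2 Hle [H|H]; [left|right]; apply Hle, H.
    + intros S' Hle Hg. eapply step_wand_left;
        [exact Hg|apply Hle, Ha|apply Hle, Hf|apply Hle, He].
Qed.

(** * The limit model *)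

Record run (Var : Type) (s : nat -> state Var) : Prop := Run {
  run_good : forall n, good (s n);
  run_step : forall n, le (s n) (s (S n));
  run_saturates : forall n, saturates n (s n) (s (S n))
}.

Lemma run_exists (Var : Type) (S0 : state Var) :
  good S0 -> exists s, run s /\ s 0 = S0.
Proof.
  intros H0.
  (* Packing goodness with the state turns the choice of a successor into a total function that can
     be iterated. *)
  assert (next : forall n (S : {S : state Var | good S}),
    {S' : {S : state Var | good S} |
      le (proj1_sig S) (proj1_sig S') /\
      saturates n (proj1_sig S) (proj1_sig S')}).
  { intros n [S HS]. apply constructive_indefinite_description.
    destruct (forceable_saturates n S) as [_ Hf].
    destruct (Hf S (le_refl S) HS) as (S' & ? & HS' & ?).
    exists (exist _ S' HS'). auto. }
  set (s := fix s n := match n with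
                       | 0 => exist _ S0 H0
                       | S m => proj1_sig (next m (s m)) end).
  exists (fun n => proj1_sig (s n)). split; [|reflexivity].
  split; intros n.
  - exact (proj2_sig (s n)).
  - exact (proj1 (proj2_sig (next n (s n)))).
  - exact (proj2 (proj2_sig (next n (s n)))).
Qed.

Definition limG (Var : Type) (s : nat -> state Var) (a : atom) : Prop :=
  exists n, In a (recG (s n)).
Definition limL (Var : Type) (s : nat -> state Var) (f : lformula Var) : Prop :=
  exists n, In f (recL (s n)).
Definition limR (Var : Type) (s : nat -> state Var) (f : lformula Var) : Prop :=
  exists n, In f (recR (s n)).
Definition eqv (Var : Type) (s : nat -> state Var) (a b : label) : Prop :=
  exists n, sub (s n) a = sub (s n) b.

Lemma run_le (Var : Type) (s : nat -> state Var) (n m : nat) :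
  run s -> n <= m -> le (s n) (s m).
Proof.
  intros Hs. induction 1; [apply le_refl|].
  eapply le_trans; [eassumption|apply run_step, Hs].
Qed.

Lemma eqv_refl (Var : Type) (s : nat -> state Var) (a : label) : eqv s a a.
Proof. exists 0. reflexivity. Qed.

Lemma eqv_sym (Var : Type) (s : nat -> state Var) (a b : label) :
  eqv s a b -> eqv s b a.
Proof. intros [n H]. exists n. auto. Qed.

Lemma eqv_trans (Var : Type) (s : nat -> state Var) (a b c : label) :
  run s -> eqv s a b -> eqv s b c -> eqv s a c.
Proof.
  intros Hs [n H1] [m H2]. exists (n + m).
  apply (le_sub (@run_le Var s n (n + m) Hs ltac:(lia))) in H1.
  apply (le_sub (@run_le Var s m (n + m) Hs ltac:(lia))) in H2.
  congruence.
Qed.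

(* Moves every membership and label equation known at some stage to stage [k]. *)
Ltac lift_to s Hs k :=
  repeat match goal with
  | H : limG s _ |- _ => destruct H as [? H]
  | H : limL s _ |- _ => destruct H as [? H]
  | H : limR s _ |- _ => destruct H as [? H]
  | H : eqv s _ _ |- _ => destruct H as [? H]
  end;
  let go H n L :=
    lazymatch n with
    | k => fail
    | _ => apply (L _ _ _ (@run_le _ s n k Hs ltac:(lia))) in H
    end in
  repeat match goal with
  | H : In _ (recG (s ?n)) |- _ => go H n (@le_recG)
  | H : In _ (recL (s ?n)) |- _ => go H n (@le_recL)
  | H : In _ (recR (s ?n)) |- _ => go H n (@le_recR)
  | H : sub (s ?n) _ = sub (s ?n) _ |- _ => go H n (@le_sub)
  end.

(** * Closure of the limit atoms under the relational rules *)

Lemma limG_unit (Var : Type) (s : nat -> state Var) (l : label) :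
  run s -> limG s (ARel l LEps l).
Proof.
  intros Hs. destruct l as [|n].
  - exists 1. apply (run_saturates Hs 0). simpl; auto.
  - exists (S n). apply (run_saturates Hs n). simpl; auto.
Qed.

Lemma limG_EM (Var : Type) (s : nat -> state Var) (l : label) :
  run s -> limG s (ANeq l LEps) \/ limG s (ARel LEps l LEps).
Proof.
  intros Hs. destruct l as [|n].
  (* For epsilon the unit atom is itself the second alternative. *)
  - right. apply limG_unit, Hs.
  - destruct (proj1 (run_saturates Hs n) (LV n)) as [_ [H|H]];
      [simpl; auto|left|right]; exists (S n); exact H.
Qed.

Lemma limG_comm (Var : Type) (s : nat -> state Var) (x y z : label) :
  run s -> limG s (ARel x y z) -> limG s (ARel y x z).
Proof.
  intros Hs [n H]. exists (S n).
  exact (proj1 (proj1 (proj2 (run_saturates Hs n)) _ H)).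
Qed.

Lemma limG_identity (Var : Type) (s : nat -> state Var) (x y z : label) :
  run s -> limG s (ARel x y z) -> eqv s x LEps -> eqv s y z.
Proof.
  intros Hs [n H] [m He].
  (* At stage [k] both the atom and the identification are present, so stage [k + 1] has discharged
     the task. *)
  set (k := n + m).
  lift_to s Hs k.
  exists (S k). exact (proj2 (proj1 (proj2 (run_saturates Hs k)) _ H) He).
Qed.

Lemma limG_split (Var : Type) (s : nat -> state Var) (z : label) :
  run s -> limG s (ANeq z LEps) -> exists x y,
    limG s (ARel x y z) /\ limG s (ANeq x LEps) /\ limG s (ANeq y LEps).
Proof.
  intros Hs [n H].
  destruct (proj1 (proj2 (run_saturates Hs n)) _ H eq_refl)
    as (x & y & ? & ? & ?).
  exists x, y. repeat split; exists (S n); assumption.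
Qed.

(** Once both sides were identified, the sequent of that stage would contain (w <> w) for a single
    label and be an axiom. *)
Lemma limG_neq (Var : Type) (s : nat -> state Var) (a b : label) :
  run s -> limG s (ANeq a b) -> ~ eqv s a b.
Proof.
  intros Hs [n H] [m He].
  set (k := n + m).
  lift_to s Hs k.
  apply (good_cur (run_good Hs k)) in H; simpl in H. rewrite He in H.
  apply (good_underivable (run_good Hs k)).
  eapply derivable_same_atoms; [|apply d_NeqL with (G := cur (s k)) (w := sub (s k) b)].
  solve_same_atoms.
Qed.

Lemma limG_pair (Var : Type) (s : nat -> state Var) (x y z u v w : label) :
  run s -> limG s (ARel x y z) -> limG s (ARel u v w) ->
  (eqv s x w -> exists k, limG s (ARel u k z) /\ limG s (ARel y v k)) /\
  (eqv s x u -> eqv s y v -> eqv s z w) /\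
  (eqv s x u -> eqv s z w -> eqv s y v) /\
  (eqv s z w -> exists p q s' t,
     limG s (ARel p q x) /\ limG s (ARel s' t y) /\
     limG s (ARel p s' u) /\ limG s (ARel q t v)).
Proof.
  intros Hs [n1 H1] [n2 H2].
  split; [|split; [|split]].
  - intros [n3 H3]. set (k := n1 + n2 + n3). lift_to s Hs k.
    destruct (proj1 (proj1 (proj2 (proj2 (run_saturates Hs k))) _ H1 _ H2) H3)
      as (l & ? & ?).
    exists l. split; exists (S k); assumption.
  - intros [n3 H3] [n4 H4]. set (k := n1 + n2 + n3 + n4). lift_to s Hs k.
    exists (S k).
    exact (proj1 (proj2 (proj1 (proj2 (proj2 (run_saturates Hs k)))
      _ H1 _ H2)) (conj H3 H4)).
  - intros [n3 H3] [n4 H4]. set (k := n1 + n2 + n3 + n4). lift_to s Hs k.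
    exists (S k).
    exact (proj1 (proj2 (proj2 (proj1 (proj2 (proj2 (run_saturates Hs k)))
      _ H1 _ H2))) (conj H3 H4)).
  - intros [n3 H3]. set (k := n1 + n2 + n3). lift_to s Hs k.
    destruct (proj2 (proj2 (proj2 (proj1 (proj2 (proj2 (run_saturates Hs k)))
      _ H1 _ H2))) H3) as (p & q & r & t & ? & ? & ? & ?).
    exists p, q, r, t. repeat split; exists (S k); assumption.
Qed.

(** * The frame of label classes *)

Definition rep (Var : Type) (s : nat -> state Var) (a : label) : label :=
  epsilon (inhabits LEps) (eqv s a).

Lemma eqv_rep (Var : Type) (s : nat -> state Var) (a : label) :
  eqv s a (rep s a).
Proof. unfold rep. apply epsilon_spec. exists a. apply eqv_refl. Qed.

(** [rep] chooses from the predicate [eqv s a]; equivalent labels receive the same choice because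
    extensionality makes their predicates equal. *)
Lemma rep_eq (Var : Type) (s : nat -> state Var) (a b : label) :
  run s -> rep s a = rep s b <-> eqv s a b.
Proof.
  intros Hs. split; intros H.
  - apply eqv_trans with (rep s a); [exact Hs|apply eqv_rep|].
    rewrite H. apply eqv_sym, eqv_rep.
  - unfold rep. f_equal. extensionality c. apply propositional_extensionality.
    split; intros; eapply eqv_trans; eauto using eqv_sym.
Qed.

(** The frame axioms use Leibniz equality, so the quotient is realized as the subtype of chosen
    representatives. *)
Definition lworld (Var : Type) (s : nat -> state Var) : Type :=
  {c : label | rep s c = c}.

Definition cls (Var : Type) (s : nat -> state Var) (Hs : run s) (a : label)
    : lworld s :=
  exist _ (rep s a) (proj2 (rep_eq _ _ Hs) (eqv_sym (eqv_rep s a))).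

Lemma label_eq_dec (a b : label) : {a = b} + {a <> b}.
Proof. decide equality. apply Nat.eq_dec. Defined.

(** The membership proofs are equations between labels, and these are unique because equality of
    labels is decidable. *)
Lemma lworld_eq (Var : Type) (s : nat -> state Var) (h1 h2 : lworld s) :
  proj1_sig h1 = proj1_sig h2 -> h1 = h2.
Proof.
  destruct h1 as [a Ha], h2 as [b Hb]; simpl; intros ->.
  f_equal. apply UIP_dec, label_eq_dec.
Qed.

Lemma cls_eq (Var : Type) (s : nat -> state Var) (Hs : run s) (a b : label) :
  cls Hs a = cls Hs b <-> eqv s a b.
Proof.
  rewrite <- (rep_eq _ _ Hs). split; intros H.
  - exact (f_equal (@proj1_sig _ _) H).
  - apply lworld_eq, H.
Qed.

Lemma cls_surj (Var : Type) (s : nat -> state Var) (Hs : run s) (h : lworld s) :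
  exists a, h = cls Hs a.
Proof.
  exists (proj1_sig h). apply lworld_eq. simpl. symmetry. apply proj2_sig.
Qed.

(** Recorded atoms are not transported along [eqv], and one world may occur under different names in
    different atoms; hence the quantification over names. *)
Definition lrel (Var : Type) (s : nat -> state Var) (Hs : run s)
    (h1 h2 h3 : lworld s) : Prop :=
  exists a b c, limG s (ARel a b c) /\
    h1 = cls Hs a /\ h2 = cls Hs b /\ h3 = cls Hs c.

Ltac unpack_lrel :=
  repeat match goal with
  | H : _ /\ _ |- _ => destruct H
  | H : lrel _ _ _ _ |- _ => destruct H as (? & ? & ? & ? & ? & ? & ?)
  end; subst;
  repeat match goal with
  | H : cls _ _ = cls _ _ |- _ => apply cls_eq in H
  end.

Lemma lrel_identity (Var : Type) (s : nat -> state Var) (Hs : run s)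
    (h1 h2 : lworld s) :
  lrel Hs h1 (cls Hs LEps) h2 <-> h1 = h2.
Proof.
  split; intros H.
  - unpack_lrel. apply cls_eq. apply limG_comm in H; [|exact Hs].
    apply limG_identity in H; auto using eqv_sym.
  - subst. destruct (cls_surj Hs h2) as [a ->]. exists a, LEps, a.
    auto using limG_unit.
Qed.

Lemma lrel_comm_impl (Var : Type) (s : nat -> state Var) (Hs : run s)
    (h1 h2 h3 : lworld s) :
  lrel Hs h1 h2 h3 -> lrel Hs h2 h1 h3.
Proof.
  intros (a & b & c & H & ? & ? & ?). exists b, a, c.
  auto using limG_comm.
Qed.

Lemma lrel_comm (Var : Type) (s : nat -> state Var) (Hs : run s)
    (h1 h2 h3 : lworld s) :
  lrel Hs h1 h2 h3 <-> lrel Hs h2 h1 h3.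
Proof. split; apply lrel_comm_impl. Qed.

Lemma lrel_assoc (Var : Type) (s : nat -> state Var) (Hs : run s)
    (h1 h2 h3 h4 h5 : lworld s) :
  lrel Hs h1 h5 h4 /\ lrel Hs h2 h3 h5 ->
  exists h6, lrel Hs h6 h3 h4 /\ lrel Hs h1 h2 h6.
Proof.
  (* Commuting puts the shared world [h5] first in one atom, where rule A expects it. *)
  intros [H1 H2]. apply lrel_comm in H1, H2.
  destruct H1 as (x & y & z & H1 & E5 & E1 & E4).
  destruct H2 as (u & v & w & H2 & E3 & E2 & E5').
  rewrite E5 in E5'. apply cls_eq in E5'.
  destruct (proj1 (limG_pair Hs H1 H2) E5') as (k & K1 & K2).
  exists (cls Hs k). split.
  - apply lrel_comm. exists u, k, z. auto.
  - exists y, v, k. auto.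
Qed.

Lemma lrel_cancel (Var : Type) (s : nat -> state Var) (Hs : run s)
    (h1 h2 h3 h4 : lworld s) :
  lrel Hs h1 h2 h3 /\ lrel Hs h1 h4 h3 -> h2 = h4.
Proof.
  intros [(x & y & z & H1 & E1 & E2 & E3) (u & v & w & H2 & E1' & E2' & E3')].
  rewrite E1 in E1'. rewrite E3 in E3'. apply cls_eq in E1', E3'.
  rewrite E2, E2'. apply cls_eq.
  apply (proj1 (proj2 (proj2 (limG_pair Hs H1 H2)))); assumption.
Qed.

Lemma lrel_functional (Var : Type) (s : nat -> state Var) (Hs : run s)
    (h1 h2 h3 h4 : lworld s) :
  lrel Hs h1 h2 h3 /\ lrel Hs h1 h2 h4 -> h3 = h4.
Proof.
  intros [(x & y & z & H1 & E1 & E2 & E3) (u & v & w & H2 & E1' & E2' & E3')].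
  rewrite E1 in E1'. rewrite E2 in E2'. apply cls_eq in E1', E2'.
  rewrite E3, E3'. apply cls_eq.
  apply (proj1 (proj2 (limG_pair Hs H1 H2))); assumption.
Qed.

Definition limit_frame (Var : Type) (s : nat -> state Var) (Hs : run s)
    : frame :=
  Frame (lrel Hs) (cls Hs LEps) (lrel_identity Hs) (lrel_comm Hs)
    (@lrel_assoc Var s Hs) (@lrel_cancel Var s Hs)
    (@lrel_functional Var s Hs).

(** Every name has been decided by EM. A name of a non-neutral world cannot carry the atom (epsilon,
    z |> epsilon), so it carries an inequality, on which S has acted. *)
Lemma limit_splittable (Var : Type) (s : nat -> state Var) (Hs : run s) :
  splittable (limit_frame Hs).
Proof.
  intros h Hh. simpl in *. destruct (cls_surj Hs h) as [z ->].
  destruct (limG_EM z Hs) as [Hz|Hz].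
  - destruct (limG_split Hs Hz) as (x & y & Hr & Hx & Hy).
    exists (cls Hs x), (cls Hs y). split; [|split].
    + intros H. apply cls_eq in H. exact (limG_neq Hs Hx H).
    + intros H. apply cls_eq in H. exact (limG_neq Hs Hy H).
    + exists x, y, z. auto.
  - exfalso. apply Hh, cls_eq, (limG_identity Hs Hz), eqv_refl.
Qed.

Lemma limit_cross_split (Var : Type) (s : nat -> state Var) (Hs : run s) :
  cross_split (limit_frame Hs).
Proof.
  intros h0 h1 h2 h3 h4.
  intros (x & y & z & H1 & E1 & E2 & E0) (u & v & w & H2 & E3 & E4 & E0').
  rewrite E0 in E0'. apply cls_eq in E0'.
  destruct (proj2 (proj2 (proj2 (limG_pair Hs H1 H2))) E0')
    as (p & q & r & t & ? & ? & ? & ?).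
  exists (cls Hs p), (cls Hs q), (cls Hs r), (cls Hs t).
  repeat split; [exists p, q, x|exists r, t, y|exists p, r, u|exists q, t, v];
    auto.
Qed.

(** * The truth lemma *)

Definition limit_val (Var : Type) (s : nat -> state Var) (Hs : run s)
    : Var -> world (limit_frame Hs) -> Prop :=
  fun p h => exists w, h = cls Hs w /\ limL s (w, CVar p).

Arguments limit_val {Var s} Hs p h.

(** Both signs are proved together since implication and wand exchange the sides, and [w] stays
    general since star and wand move to other labels. *)
Lemma limit_truth (Var : Type) (s : nat -> state Var) (Hs : run s)
    (A : cformula Var) : forall w,
  (limL s (w, A) -> cforces (limit_frame Hs) (limit_val Hs) (cls Hs w) A) /\
  (limR s (w, A) -> ~ cforces (limit_frame Hs) (limit_val Hs) (cls Hs w) A).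
Proof.
  assert (realizeL : forall f, limL s f -> consumedL f ->
            exists n, realL (s n) f).
  { intros f [n Hn] Hc. exists (S n).
    destruct (run_saturates Hs n) as (_ & _ & _ & HL & _). auto. }
  assert (realizeR : forall f, limR s f -> consumedR f ->
            exists n, realR (s n) f).
  { intros f [n Hn] Hc. exists (S n).
    destruct (run_saturates Hs n) as (_ & _ & _ & _ & HR & _). auto. }
  induction A as [p| | |A IHA B IHB|A IHA B IHB| |A IHA B IHB|A IHA B IHB];
    intros w; split; intros H; simpl.
  - exists w. auto.
  (* The two occurrences may have different names; once these are identified, the sequent is an
     instance of the identity axiom. *)
  - intros (w' & He & H'). apply cls_eq in He.
    destruct H as [n H], H' as [m H'], He as [l He].
    set (k := n + m + l). lift_to s Hs k.
    pose proof (run_good Hs k) as Hg.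
    apply (persistentR _ Hg) in H; [|exact (fun K => K)].
    apply (persistentL _ Hg) in H'; [|exact (fun K => K)].
    destruct (in_perm _ _ H) as [r Hr], (in_perm _ _ H') as [r' Hr'].
    apply (@good_underivable_perm Var (s k) (cur (s k)) _ _ Hg
      ltac:(tauto) Hr' Hr).
    simpl. unfold map_lf at 1 3; simpl. rewrite He. apply d_id.
  - exact I.
  - intros _. destruct H as [n H]. pose proof (run_good Hs n) as Hg.
    apply (persistentR _ Hg) in H; [|exact (fun K => K)].
    destruct (in_perm _ _ H) as [r Hr].
    apply (@good_underivable_perm Var (s n) (cur (s n)) _ _ Hg
      ltac:(tauto) (Permutation_refl _) Hr).
    apply d_TopR.
  - destruct H as [n H]. pose proof (run_good Hs n) as Hg.
    apply (persistentL _ Hg) in H; [|exact (fun K => K)].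
    destruct (in_perm _ _ H) as [r Hr].
    apply (@good_underivable_perm Var (s n) (cur (s n)) _ _ Hg
      ltac:(tauto) Hr (Permutation_refl _)).
    apply d_BotL.
  - tauto.
  - destruct (realizeL _ H I) as (n & ? & ?).
    split; [apply IHA|apply IHB]; exists n; assumption.
  - intros [HA HB]. destruct (realizeR _ H I) as (n & [K|K]).
    + apply (IHA w) in HA; [exact HA|exists n; exact K].
    + apply (IHB w) in HB; [exact HB|exists n; exact K].
  - intros HA. destruct (realizeL _ H I) as (n & [K|K]).
    + apply (IHA w) in HA; [contradiction|exists n; exact K].
    + apply IHB. exists n; exact K.
  - intros HAB. destruct (realizeR _ H I) as (n & K1 & K2).
    apply (proj2 (IHB w)); [exists n; exact K2|].
    apply HAB, IHA. exists n; exact K1.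
  - destruct (realizeL _ H I) as (n & K). simpl in K.
    apply cls_eq. apply limG_identity with (x := LEps);
      [exact Hs|exists n; exact K|apply eqv_refl].
  - intros He. apply cls_eq in He. destruct H as [n H], He as [m He].
    set (k := n + m). lift_to s Hs k.
    pose proof (run_good Hs k) as Hg.
    apply (persistentR _ Hg) in H; [|exact (fun K => K)].
    destruct (in_perm _ _ H) as [r Hr].
    apply (@good_underivable_perm Var (s k) (cur (s k)) _ _ Hg
      ltac:(tauto) (Permutation_refl _) Hr).
    simpl. unfold map_lf at 2; simpl. rewrite He, (good_eps Hg).
    apply d_EmpR.
  - destruct (realizeL _ H I) as (n & x & y & K & KA & KB).
    exists (cls Hs x), (cls Hs y). split; [|split].
    + exists x, y, w. repeat split; auto. exists n; exact K.
    + apply IHA. exists n; exact KA.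
    + apply IHB. exists n; exact KB.
  - intros (h1 & h2 & (x & y & z & K & -> & -> & He) & HA & HB).
    (* The atom splits the world of [w] under some name [z]; at a stage where [z] and [w] agree,
       [star_task] makes one component false. *)
    apply cls_eq, eqv_sym in He.
    destruct H as [n H], K as [m K], He as [l He].
    set (k := n + m + l). lift_to s Hs k.
    destruct (run_saturates Hs k) as (_ & _ & _ & _ & _ & Hstar & _).
    destruct (Hstar _ K _ H He) as [Q|Q].
    + apply (proj2 (IHA x)); [exists (S k); exact Q|exact HA].
    + apply (proj2 (IHB y)); [exists (S k); exact Q|exact HB].
  (* Forcing puts the world of the wand first in the relation, the left wand rule puts it second. *)
  - intros h1 h2 Hr HA. apply lrel_comm in Hr.
    destruct Hr as (x & y & z & K & -> & He & ->).
    apply cls_eq, eqv_sym in He.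
    destruct H as [n H], K as [m K], He as [l He].
    set (k := n + m + l). lift_to s Hs k.
    destruct (run_saturates Hs k) as (_ & _ & _ & _ & _ & _ & Hwand).
    destruct (Hwand _ K _ H He) as [Q|Q].
    + exfalso. apply (proj2 (IHA x)); [exists (S k); exact Q|exact HA].
    + apply IHB. exists (S k); exact Q.
  - intros HAB. destruct (realizeR _ H I) as (n & x & y & K & KA & KB).
    apply (proj2 (IHB y)); [exists n; exact KB|].
    apply (HAB (cls Hs x)).
    + apply lrel_comm. exists x, w, y. repeat split; auto. exists n; exact K.
    + apply IHA. exists n; exact KA.
Qed.

Theorem mainTheorem12 : forall (Var : Type) (F : formula Var),
  ((exists w : LVar, derivable true [] [] [(LV w, desugar F)]) ->
   valid_over (fun M => splittable M /\ cross_split M) F) /\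
  (valid_over (fun M => splittable M /\ cross_split M) F ->
   exists w : LVar, derivable false [] [] [(LV w, desugar F)]).
Proof.
  intros Var F. split.
  - intros [w Hd] M [Hsp Hcs] nu h. apply NNPP. intros Hn.
    apply (derivable_not_refutable Hsp Hcs Hd (nu := nu))
      (* Only one label occurs in the sequent, so every variable may denote [h]. *)
      with (rho := fun l => match l with LEps => neutral | LV _ => h end).
    split; [reflexivity|repeat split; repeat constructor].
    unfold lholds. simpl. rewrite cforces_desugar. exact Hn.
  - intros Hv. exists 0. apply NNPP. intros Hn.
    (* The root formula is recorded and pending, with no identification made; the choice of variable
       0 is arbitrary. *)
    set (S0 := State [] [] [] [(LV 0, desugar F)] [] [(LV 0, desugar F)]
                 (fun l => l)).
    assert (H0 : good S0).
    { split; simpl; auto; try tauto. exists 0; auto. }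
    destruct (run_exists H0) as (s & Hs & Es).
    apply (proj2 (limit_truth Hs (desugar F) (LV 0))).
    + exists 0. rewrite Es. simpl; auto.
    + apply cforces_desugar, Hv.
      split; [apply limit_splittable|apply limit_cross_split].
Qed.
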